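(* Let $\mathcal{K}=(K,\preccurlyeq_{\mathcal{K}})$ be an abstract elementary class and let $M\in K$ be a homogeneous model with $|M|=\kappa>\mathrm{LS}(\mathcal{K})$ and $\kappa^{<\kappa}=\kappa$. Assume that $\mathcal{K}^{<}(M)$ is a strong amalgamation class. Equip $\mathrm{Aut}(M)$ with the topology $\mathfrak{T}^{\mathrm{cl}}$, and let $H\leqslant\mathrm{Aut}(M)$ be a subgroup with $[\mathrm{Aut}(M):H]\leq\kappa$. Then $H$ is an open subgroup of $\mathrm{Aut}(M)$; i.e., there exists $A\in\mathcal{K}^{<}(M)$ such that $\mathrm{Aut}_A(M)\leqslant H$. In other words, $(\mathrm{Aut}(M),\mathfrak{T}^{\mathrm{cl}})$ has the small index property.
   Context: $\mathrm{LS}(\mathcal{K})$ is the Löwenheim–Skolem number of the AEC. $\mathcal{K}^{<}(M)=\{N: N\preccurlyeq_{\mathcal{K}}M,\ |N|<\kappa\}$. $M$ is homogeneous if every isomorphism $f:N_1\to N_2$ with $N_1,N_2\in\mathcal{K}^{<}(M)$ extends to an automorphism of $M$. For $A\subseteq M$, $\mathrm{cl}^M(A)=\bigcap\{N\in K: A\subseteq N\preccurlyeq_{\mathcal{K}}M\}$, and $\mathcal{C}=\{\mathrm{cl}^M(A): A\subseteq M,\ |A|<\kappa\}$. $\mathrm{Aut}_X(M)$ is the pointwise stabilizer of $X$ in $\mathrm{Aut}(M)$. $\mathfrak{T}^{\mathrm{cl}}$ is the group topology on $\mathrm{Aut}(M)$ generated by the cosets of the subgroups $\mathrm{Aut}_X(M)$,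 $X\in\mathcal{C}$ (these stabilizers form a basis of neighbourhoods of the identity). A ''sequence of automorphisms'' $(g_i:i\in I)$ always has $|I|<\kappa$ (repetitions allowed); one sequence extends another with the same index set if it does so coordinatewise. For $M_0,M_1,M_2\in\mathcal{K}^{<}(M)$ with $M_0\preccurlyeq_{\mathcal{K}}M_1,M_2$, a sequence $\gamma^0$ of automorphisms of $M_0$, and sequences $\gamma^1,\gamma^2$ of automorphisms of $M_1,M_2$ both extending $\gamma^0$: $\gamma^1,\gamma^2$ are compatible over $M_0$ if there exist $M_3\in\mathcal{K}^{<}(M)$ and $\alpha_1,\alpha_2\in\mathrm{Aut}_{M_0}(M)$ with $\alpha_1[M_1],\alpha_2[M_2]\preccurlyeq_{\mathcal{K}}M_3$ and a sequence $\gamma^3$ of automorphisms of $M_3$ extending both $\alpha_1\circ\gamma^1\circ\alpha_1^{-1}\restriction\alpha_1[M_1]$ and $\alpha_2\circ\gamma^2\circ\alpha_2^{-1}\restriction\alpha_2[M_2]$ (coordinatewise). For $N_0\in\mathcal{K}^{<}(M)$ and a sequence $\gamma^0$ of automorphisms of $N_0$, $(N_0,\gamma^0)$ is a strong amalgamation base if for all $N_1,N_2\in\mathcal{K}^{<}(M)$ with $N_0\preccurlyeq_{\mathcal{K}}N_1,N_2$, any sequences of automorphisms of $N_1$ and of $N_2$ extending $\gamma^0$ are compatible over $N_0$. $\mathcal{K}^{<}(M)$ is a strong amalgamation class if $(N,\gamma)$ is a strong amalgamation base for every $N\in\mathcal{K}^{<}(M)$ and every sequence $\gamma$ of automorphisms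 of $N$. *)

(* Defs.v *)
From HB Require Import structures.
From mathcomp Require Import all_boot.
From mathcomp Require Import boolp classical_sets functions cardinality wochoice.
From mathcomp Require Import topology.

Set Implicit Arguments.
Unset Strict Implicit.
Unset Printing Implicit Defensive.

Local Open Scope classical_set_scope.
Local Open Scope card_scope.

Definition card_lt T U (A : set T) (B : set U) : Prop :=
  A #<= B /\ ~ (B #<= A).
Notation "A '#<' B" := (card_lt A B) (at level 79) : card_scope.

(* |B| = |A|^{<|A|}, i.e. |B| is the supremum of the cardinals |A|^|X| over
   all X with |X| < |A|. *)
Definition is_weak_power T U (A : set T) (B : set U) : Prop :=
  (forall X : Type, [set: X] #< A -> [set: X -> set_type A] #<= B) /\
  (forall Y : Type,
     (forall X : Type, [set: X] #< A -> [set: X -> set_type A] #<= [set: Y]) ->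
     B #<= [set: Y]).

Record language := Language {
  fsym : Type;
  farity : fsym -> nat;
  rsym : Type;
  rarity : rsym -> nat
}.

(* The universe of a structure is a subset [dom] of an ambient type [T], so
   that inclusion of structures over the same [T] is literal set inclusion.
   The values of the interpretations on tuples not contained in [dom] are junk
   and are never inspected. *)
Record structure (L : language) (T : Type) := Structure {
  dom : set T;
  dom_neq0 : dom !=set0;
  fint : forall s : fsym L, ('I_(farity s) -> T) -> T;
  rint : forall s : rsym L, ('I_(rarity s) -> T) -> Prop;
  fint_dom : forall s (x : 'I_(farity s) -> T),
    (forall i, dom (x i)) -> dom (fint x)
}.
Arguments fint {L T} _ s x.
Arguments rint {L T} _ s x.

Section Structures.
Variable L : language.

Definition substructure T (M N : structure L T) : Prop :=
  [/\ dom M `<=` dom N,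
      forall s (x : 'I_(farity s) -> T),
        (forall i, dom M (x i)) -> fint M s x = fint N s x
    & forall s (x : 'I_(rarity s) -> T),
        (forall i, dom M (x i)) -> (rint M s x <-> rint N s x)].

(* Only the restriction of [f] to [dom M] is relevant. *)
Definition isomorphism T U (M : structure L T) (N : structure L U) (f : T -> U)
    : Prop :=
  [/\ set_bij (dom M) (dom N) f,
      forall s (x : 'I_(farity s) -> T),
        (forall i, dom M (x i)) -> f (fint M s x) = fint N s (f \o x)
    & forall s (x : 'I_(rarity s) -> T),
        (forall i, dom M (x i)) -> (rint M s x <-> rint N s (f \o x))].

End Structures.

Section Automorphisms.
Variables (L : language) (T : Type).
Implicit Type M : structure L T.

(* An automorphism of [M] is represented by its unique extension to [T] that
   fixes every point outside [dom M]. *)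
Record aut M := Aut {
  aut_fun :> T -> T;
  aut_isom : isomorphism M M aut_fun;
  aut_out : forall x, ~ dom M x -> aut_fun x = x
}.

Lemma aut_eq M (g h : aut M) : g =1 h -> g = h.
Proof.
case: g h => [g g1 g2] [h h1 h2] /= /funext e; subst h.
by congr Aut; exact: Prop_irrelevance.
Qed.

HB.instance Definition _ M := gen_eqMixin (aut M).
HB.instance Definition _ M := gen_choiceMixin (aut M).

Lemma isom_id M : isomorphism M M id.
Proof. by split=> //; split=> // x Mx; exists x. Qed.

Definition aut_one M : aut M := @Aut M id (isom_id M) (fun _ _ => erefl).

Lemma aut_dom M (g : aut M) x : dom M x -> dom M (g x).
Proof. by case: (aut_isom g) => -[gM _ _] _ _ /gM. Qed.

Lemma isom_comp M (g h : aut M) : isomorphism M M (g \o h).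
Proof.
have [[_ gi gs] gf gr] := aut_isom g; have [[_ hi hs] hf hr] := aut_isom h.
split.
- split.
  + by move=> x Mx /=; do 2 apply: aut_dom.
  + move=> x y; rewrite !inE => Mx My /= e.
    by apply: hi; rewrite ?inE //; apply: gi; rewrite ?inE //; apply: aut_dom.
  + by move=> z /gs[y /hs[x Mx <-] <-]; exists x.
- by move=> s x Mx /=; rewrite hf// gf// => i; apply: aut_dom.
- move=> s x Mx; rewrite hr// gr// => i; exact: aut_dom.
Qed.

Lemma aut_comp_out M (g h : aut M) x : ~ dom M x -> (g \o h) x = x.
Proof. by move=> Mx /=; rewrite (aut_out h)// aut_out. Qed.

Definition aut_mul M (g h : aut M) : aut M :=
  Aut (isom_comp g h) (@aut_comp_out M g h).

Lemma aut_inv_ex M (g : aut M) : exists h : aut M, cancel h g /\ cancel g h.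
Proof.
have [[gM gi gs] gf gr] := aut_isom g.
have gout x : ~ dom M x -> ~ dom M (g x) by move=> Mx; rewrite aut_out.
have ginj : injective g.
  move=> x y e; have [Mx|Mx] := pselect (dom M x).
    have [My|My] := pselect (dom M y); first by apply: gi; rewrite ?inE.
    by case: (gout _ My); rewrite -e; exact: gM.
  have [My|My] := pselect (dom M y); last by rewrite -(aut_out g Mx) e aut_out.
  by case: (gout _ Mx); rewrite e; exact: gM.
have ex y : exists x, g x = y.
  have [/gs[x _ <-]|My] := pselect (dom M y); first by exists x.
  by exists y; rewrite aut_out.
have [h hK] := choice ex.
have hK' : cancel g h by move=> x; apply: ginj; rewrite hK.
have hM x : dom M x -> dom M (h x).
  by move=> /gs[y My <-]; rewrite hK'.
have hout x : ~ dom M x -> h x = x by move=> Mx; rewrite -{1}(aut_out g Mx) hK'.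
have hi : isomorphism M M h.
  have ghx n (x : 'I_n -> T) : g \o (h \o x) = x.
    by apply: funext => i /=; rewrite hK.
  split.
  - split=> //; first by move=> x y _ _ e; rewrite -(hK x) e hK.
    by move=> x Mx; exists (g x); [exact: gM|rewrite hK'].
  - by move=> s x Mx; apply: ginj; rewrite hK gf ?ghx// => i; exact: hM.
  - move=> s x Mx; have := gr s (h \o x) (fun i => hM _ (Mx i)).
    by rewrite ghx => -[? ?]; split.
by exists (Aut hi hout).
Qed.

Definition aut_inv M (g : aut M) : aut M := projT1 (cid (aut_inv_ex g)).

Lemma aut_invK M (g : aut M) : cancel (aut_inv g) g.
Proof. by rewrite /aut_inv; case: cid => h []. Qed.

Lemma aut_Kinv M (g : aut M) : cancel g (aut_inv g).
Proof. by rewrite /aut_inv; case: cid => h []. Qed.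

Lemma aut_mulA M : associative (@aut_mul M).
Proof. by move=> f g h; apply: aut_eq. Qed.
Lemma aut_mul1 M : left_id (aut_one M) (@aut_mul M).
Proof. by move=> g; apply: aut_eq. Qed.
Lemma aut_1mul M : right_id (aut_one M) (@aut_mul M).
Proof. by move=> g; apply: aut_eq. Qed.
Lemma aut_mulV M : left_inverse (aut_one M) (@aut_inv M) (@aut_mul M).
Proof. by move=> g; apply: aut_eq => x /=; rewrite aut_Kinv. Qed.
Lemma aut_Vmul M : right_inverse (aut_one M) (@aut_inv M) (@aut_mul M).
Proof. by move=> g; apply: aut_eq => x /=; rewrite aut_invK. Qed.

HB.instance Definition _ M := isGroup.Build (aut M)
  (@aut_mulA M) (@aut_mul1 M) (@aut_1mul M) (@aut_mulV M) (@aut_Vmul M).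

Definition pw_stab M (X : set T) : set (aut M) :=
  [set g | forall x, X x -> g x = x].

Section Image.
Variables (M N : structure L T) (a : aut M).

Lemma image_neq0 : a @` dom N !=set0.
Proof. by have [x Nx] := dom_neq0 N; exists (a x); exists x. Qed.

Lemma image_fint_dom s (x : 'I_(farity s) -> T) :
  (forall i, (a @` dom N) (x i)) ->
  (a @` dom N) (a (fint N s ((a^-1)%g \o x))).
Proof.
move=> Nx; exists (fint N s ((a^-1)%g \o x)) => //; apply: fint_dom => i /=.
by have [y Ny <-] := Nx i; rewrite [X in dom _ X]aut_Kinv.
Qed.

Definition image_structure : structure L T :=
  @Structure L T (a @` dom N) image_neq0
    (fun s x => a (fint N s ((a^-1)%g \o x)))
    (fun s x => rint N s ((a^-1)%g \o x))
    image_fint_dom.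
End Image.

End Automorphisms.

(* [inK] plays the role of K. Each structure lives over some ambient type, and
   [prec] relates structures over a common one; the closure under isomorphism
   required below ranges over all pairs of ambient types. *)
Record ordered_class (L : language) := OrderedClass {
  inK : forall T : Type, structure L T -> Prop;
  prec : forall T : Type, structure L T -> structure L T -> Prop
}.

Section AEC.
Variables (L : language) (K : ordered_class L).

(* An increasing continuous chain, indexed by a limit ordinal given as a
   well-ordered type [(I, le)] without last element. An index [i] is a limit
   when it is not minimal and has no immediate predecessor. *)
Section Chain.
Variables (I : Type) (le : rel I).
Let lt i j := le i j /\ i <> j.

Definition limit_order : Prop :=
  [/\ wochoice.well_order le, inhabited I & forall i, exists j, lt i j].

Definition limit_index (i : I) : Prop :=
  (exists j, lt j i) /\ (forall j, lt j i -> exists k, lt j k /\ lt k i).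

Definition continuous_chain T (C : I -> structure L T) : Prop :=
  [/\ forall i, inK K (C i),
      forall i j, le i j -> prec K (C i) (C j)
    & forall i, limit_index i ->
        dom (C i) = \bigcup_(j in [set j | lt j i]) dom (C j)].
End Chain.

Definition is_union I T (C : I -> structure L T) (U : structure L T) : Prop :=
  dom U = \bigcup_i dom (C i) /\ (forall i, substructure (C i) U).

(* [lam] is a cardinal, at least |L| + aleph_0, for which the
   Loewenheim-Skolem axiom holds. *)
Definition LS_bound (lam : Type) : Prop :=
  [set: (fsym L + rsym L + nat)%type] #<= [set: lam] /\
  (forall T (M : structure L T) (A : set T), inK K M -> A `<=` dom M ->
     exists N : structure L T,
       [/\ prec K N M, A `<=` dom N
         & dom N #<= [set: (set_type A + lam)%type]]).

(* [lam] is the cardinal LS(K), the least one as above. *)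
Definition is_LS_number (lam : Type) : Prop :=
  LS_bound lam /\ (forall mu : Type, LS_bound mu -> [set: lam] #<= [set: mu]).

Record is_AEC : Prop := IsAEC {
  prec_inK : forall T (M N : structure L T),
    prec K M N -> inK K M /\ inK K N;
  prec_refl : forall T (M : structure L T), inK K M -> prec K M M;
  prec_trans : forall T (M N P : structure L T),
    prec K M N -> prec K N P -> prec K M P;
  prec_sub : forall T (M N : structure L T), prec K M N -> substructure M N;
  inK_isom : forall T U (M : structure L T) (N : structure L U) (f : T -> U),
    isomorphism M N f -> inK K M -> inK K N;
  prec_isom : forall T U (M0 M : structure L T) (N0 N : structure L U)
      (f : T -> U),
    isomorphism M N f -> isomorphism M0 N0 f ->
    prec K M0 M -> prec K N0 N;
  coherence : forall T (M0 M1 M2 : structure L T),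
    substructure M0 M1 -> prec K M0 M2 -> prec K M1 M2 -> prec K M0 M1;
  chain_union : forall (I : Type) (le : rel I) T (C : I -> structure L T)
      (U : structure L T),
    limit_order le -> continuous_chain le C -> is_union C U ->
    [/\ inK K U, forall i, prec K (C i) U
      & forall N, (forall i, prec K (C i) N) -> prec K U N];
  LS_axiom : exists lam : Type, LS_bound lam
}.

Section Model.
Variables (T : Type) (M : structure L T).

(* K^<(M), with kappa = |M| *)
Definition small_sub : set (structure L T) :=
  [set N | prec K N M /\ dom N #< dom M].

Definition homogeneous : Prop :=
  forall (N1 N2 : structure L T) (f : T -> T),
    small_sub N1 -> small_sub N2 -> isomorphism N1 N2 f ->
    exists g : aut M, forall x, dom N1 x -> g x = f x.

Definition cl (A : set T) : set T :=
  \bigcap_(N in [set N : structure L T |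
                  [/\ inK K N, A `<=` dom N & prec K N M]]) dom N.

Definition closed_small : set (set T) :=
  [set cl A | A in [set A : set T | A `<=` dom M /\ A #< dom M]].

(* Sequences indexed by [I] are functions [I -> aut N]; the condition
   |I| < kappa is stated where the sequences are quantified. *)
Definition seq_extends (I : Type) (N0 N1 : structure L T)
    (c0 : I -> aut N0) (c1 : I -> aut N1) : Prop :=
  forall i x, dom N0 x -> c1 i x = c0 i x.

Definition compatible (I : Type) (M0 M1 M2 : structure L T)
    (c1 : I -> aut M1) (c2 : I -> aut M2) : Prop :=
  exists (M3 : structure L T) (a1 a2 : aut M) (c3 : I -> aut M3),
    [/\ small_sub M3,
        pw_stab (dom M0) a1 /\ pw_stab (dom M0) a2,
        prec K (image_structure M1 a1) M3 /\ prec K (image_structure M2 a2) M3,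
        forall i x, (a1 @` dom M1) x -> c3 i x = a1 (c1 i ((a1^-1)%g x))
      & forall i x, (a2 @` dom M2) x -> c3 i x = a2 (c2 i ((a2^-1)%g x))].

Definition strong_amalgamation_base (I : Type) (N0 : structure L T)
    (c0 : I -> aut N0) : Prop :=
  forall N1 N2 : structure L T, small_sub N1 -> small_sub N2 ->
    prec K N0 N1 -> prec K N0 N2 ->
    forall (c1 : I -> aut N1) (c2 : I -> aut N2),
      seq_extends c0 c1 -> seq_extends c0 c2 -> compatible N0 c1 c2.

Definition strong_amalgamation_class : Prop :=
  forall N : structure L T, small_sub N ->
    forall I : Type, [set: I] #< dom M ->
      forall c : I -> aut N, strong_amalgamation_base c.

End Model.
End AEC.

(* Aut(M) with the topology generated by the cosets of the stabilizers of the
   members of [closed_small K M]. Left cosets suffice: as [closed_small K M] is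
   invariant under Aut(M), each right coset is also a left coset of some such
   stabilizer. *)
Definition aut_cl (L : language) (K : ordered_class L) (T : Type)
  (M : structure L T) : Type := aut M.

Definition left_coset (G : groupType) (H : set G) (g : G) : set G :=
  [set (g * h)%g | h in H].

HB.instance Definition _ (L : language) (K : ordered_class L) (T : Type)
  (M : structure L T) := Group.on (aut_cl K M).

Definition stab_cosets (L : language) (K : ordered_class L) (T : Type)
    (M : structure L T) : set (set (aut_cl K M)) :=
  [set C | exists X g, closed_small K M X /\ C = left_coset (@pw_stab L T M X) g].

HB.instance Definition _ (L : language) (K : ordered_class L) (T : Type)
  (M : structure L T) :=
  isSubBaseTopological.Build (aut_cl K M) (@stab_cosets L K T M) id.

Definition subgroup (G : groupType) (H : set G) : Prop := group_closed (mem H).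

(* The set of left cosets, whose cardinality is the index [G : H]. *)
Definition cosets (G : groupType) (H : set G) : set (set G) :=
  range (left_coset H).

(* Main.v *)
Require Import Defs.
From mathcomp Require Import all_boot.
From mathcomp Require Import boolp classical_sets functions cardinality topology.
From mathcomp Require Import wochoice.

Set Implicit Arguments.
Unset Strict Implicit.
Unset Printing Implicit Defensive.

Local Open Scope classical_set_scope.
Local Open Scope card_scope.

(** Write G = Aut(M). A sequence of automorphisms is generic when every extension
    of its restriction to a small strong submodel is realized inside M; two
    generic sequences with conjugate restrictions to small strong submodels are
    conjugate, by back-and-forth.

    Pick a set W of kappa automorphisms meeting every nonempty intersection of a
    coset of a conjugate of H with a basic open set; such a W exists because the
    index of H and kappa^{<kappa} are at most kappa. Strong amalgamation and
    homogeneity give a sequence (u_j : j < kappa) such that all the sequences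
    (u_j w_j : j <= t) with t < kappa and w_j in W are generic: there are only
    kappa tasks. Genericity thus survives the choice of the w_j, which decides in
    which coset each u_j w_j lies and how it acts on a given small set.

    Let g_j H (j < kappa) be the cosets of H, and suppose that H contains no
    Aut_A(M) with A small. Build h in G in kappa steps. At step j, with h known
    on a small D, choose a_j = u_j w_j in H fixing D pointwise and
    z_j = u_j w'_j outside g_j H g_j^{-1} fixing h[D] pointwise, then extend h so
    that h a_j h^{-1} = z_j holds on larger and larger sets. In the limit
    h a_j h^{-1} = z_j for all j, so h lies in no coset g_j H. *)

(** * Well-orders *)

Section WellOrder.
Variables (J : Type) (le : rel J).
Hypothesis wo : wochoice.well_order le.

Lemma wo_minimum (P : set J) : P !=set0 -> exists2 z, P z & forall x, P x -> le z x.
Proof.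
move=> [x Px]; have [|z [[zP zm] _]] := @wo [pred y | `[< P y >]].
  by exists x; exact: asboolT.
exists z; first exact: (asboolW zP).
by move=> y Py; apply: zm; exact: asboolT.
Qed.

Lemma wo_total x y : le x y \/ le y x.
Proof.
have [|z [->|->] zm] := @wo_minimum [set t | t = x \/ t = y].
- by exists x; left.
- by left; apply: zm; right.
- by right; apply: zm; left.
Qed.

Lemma wo_refl x : le x x.
Proof. by case: (wo_total x x). Qed.

Lemma wo_anti x y : le x y -> le y x -> x = y.
Proof.
move=> xy yx; have [|z [_ u]] := @wo [pred t | `[< t = x \/ t = y >]].
  by exists x; apply: asboolT; left.
rewrite -(u x) ?(u y) //; split.
- by apply: asboolT; right.
- by move=> t /asboolW[->|->] //; exact: wo_refl.
- by apply: asboolT; left.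
- by move=> t /asboolW[->|->] //; exact: wo_refl.
Qed.

Lemma wo_trans y x z : le x y -> le y z -> le x z.
Proof.
move=> xy yz.
have [|t tP tm] := @wo_minimum [set t | [\/ t = x, t = y | t = z]].
  by exists x; constructor 1.
have [tx ty tz] : [/\ le t x, le t y & le t z].
  by split; apply: tm; [constructor 1|constructor 2|constructor 3].
case: tP => et; move: tx ty tz; rewrite et => // zx zy _.
- by rewrite (wo_anti xy zx).
- by rewrite -(wo_anti yz zy).
Qed.

Lemma wo_not_le x y : ~ le x y -> le y x /\ y <> x.
Proof.
by move=> nxy; case: (wo_total x y) => // yx; split=> // e; apply: nxy; rewrite e wo_refl.
Qed.

Lemma wo_ind (P : J -> Prop) :
  (forall i, (forall j, le j i -> j <> i -> P j) -> P i) -> forall i, P i.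
Proof.
move=> step i; apply: contrapT => nPi.
have [|z nPz zm] := @wo_minimum [set j | ~ P j]; first by exists i.
apply: nPz; apply: step => j jz nzj; apply: contrapT => nPj.
by apply: nzj; apply: wo_anti => //; exact: zm.
Qed.

Lemma wo_restrict (P : set J) :
  wochoice.well_order (fun i j : P => le (val i) (val j)).
Proof.
apply: antisymmetric_well_order.
  by move=> i j /andP[ij ji]; apply: val_inj; apply: wo_anti.
move=> A [i Ai].
have [|_ [j Aj ->] jm] := @wo_minimum [set y | exists2 i, i \in A & y = val i].
  by exists (val i), i.
by exists j; split=> // k Ak; apply: jm; exists k.
Qed.

Lemma wo_max x y : exists z, le x z /\ le y z.
Proof.
by case: (wo_total x y) => [xy|yx]; [exists y|exists x]; split=> //; exact: wo_refl.
Qed.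

Lemma wo_wf : well_founded (fun j i => le j i /\ j <> i).
Proof. by elim/wo_ind => i IH; constructor => j [ji nji]; exact: IH. Qed.

(** This serves the transfinite constructions below, where stage [i] is constrained by the earlier
    stages but not computed from them. A history is a total function on [J]; the first premise makes
    its values at indices that are not below [i] irrelevant. *)
Lemma wo_recursion (S : Type) (s0 : S) (P : J -> (J -> S) -> S -> Prop) :
  (forall i f g x, (forall j, le j i -> j <> i -> f j = g j) -> P i f x -> P i g x) ->
  (forall i f, (forall j, le j i -> j <> i -> P j f (f j)) -> exists x, P i f x) ->
  exists f, forall i, P i f (f i).
Proof.
move=> ext step.
have ex i f : exists x, (exists y, P i f y) -> P i f x.
  by have [[y Py]|n] := pselect (exists y, P i f y); [exists y|exists s0].
pose pick i f : S := projT1 (cid (ex i f)).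
have pickP i f : (exists y, P i f y) -> P i f (pick i f) := projT2 (cid (ex i f)).
(* The value [s0] only completes the partial history to a total function. *)
pose F i (rec : forall j, le j i /\ j <> i -> S) : S :=
  pick i (fun j => if pselect (le j i /\ j <> i) is left h then rec j h else s0).
pose f := Fix wo_wf (fun=> S) F.
have fE i : f i = pick i (fun j => if pselect (le j i /\ j <> i) is left h then f j else s0).
  rewrite /f Init.Wf.Fix_eq //.
  move=> x r1 r2 e; rewrite /F; congr pick; apply: funext => j.
  by case: pselect => //.
exists f; elim/wo_ind => i IH.
have agree j : le j i -> j <> i ->
    f j = if pselect (le j i /\ j <> i) is left h then f j else s0.
  by move=> ji nji; case: pselect => // -[].
rewrite fE; apply: (ext _ _ _ _ (fun j ji nji => esym (agree j ji nji))).
apply: pickP; have [y Py] := step i f IH.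
by exists y; exact: ext Py.
Qed.
End WellOrder.

Lemma wo_finite_bound J (le : rel J) n (c : 'I_n -> J) :
  wochoice.well_order le -> inhabited J -> exists i, forall k, le (c k) i.
Proof.
move=> wo [j0]; elim: n c => [|n IH] c; first by exists j0 => -[].
have [i ic] := IH (fun k => c (lift ord0 k)).
have bound j : le i j -> le (c ord0) j -> forall k, le (c k) j.
  by move=> ij cj k; case: (unliftP ord0 k) => [k' ->|->] //; exact: wo_trans (ic k') ij.
have [ci|ic0] := wo_total wo (c ord0) i.
  by exists i; apply: bound => //; exact: wo_refl.
by exists (c ord0); apply: bound => //; exact: wo_refl.
Qed.

(** Symbols are finitary, so every atomic condition on the union of a chain can be checked at a
    single stage. *)
Lemma finite_tuple_in_chain J (le : rel J) T (D : J -> set T) n (x : 'I_n -> T) :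
  wochoice.well_order le -> inhabited J -> (forall i j, le i j -> D i `<=` D j) ->
  (forall k, (\bigcup_i D i) (x k)) -> exists i, forall k, D i (x k).
Proof.
move=> wo J0 mono xD.
have /choice[c cP] : forall k, exists i, D i (x k).
  by move=> k; have [i _ Di] := xD k; exists i.
by have [i ci] := wo_finite_bound c wo J0; exists i => k; apply: mono (ci k) _ (cP k).
Qed.

Lemma wo_leq : wochoice.well_order leq.
Proof.
apply: antisymmetric_well_order; first exact: anti_leq.
move=> A [n An]; have ex : exists n, n \in A by exists n.
by exists (ex_minn ex); case: ex_minnP => m Am mm; split=> // k; exact: mm.
Qed.

(** * Small sets *)

Section Small.
Variable I : Type.

Definition narrow (A : set I) := forall f : I -> I, exists i, forall a, A a -> f a <> i.

(* |X| < |I|, expressed without comparing cardinals in general: [X] is covered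
   by the image of a subset of [I] that does not surject onto [I]. *)
Definition small V (X : set V) :=
  exists (A : set I) (phi : I -> option V),
    (forall x, X x -> exists2 a, A a & phi a = Some x) /\ narrow A.

Lemma sub_small V (X Y : set V) : X `<=` Y -> small Y -> small X.
Proof. by move=> XY [A [phi [cov nA]]]; exists A, phi; split=> // x /XY/cov. Qed.

Lemma small_image V W (f : V -> W) (X : set V) : small X -> small (f @` X).
Proof.
move=> [A [phi [cov nA]]]; exists A, (fun a => omap f (phi a)).
by split=> // _ [x /cov[a Aa e] <-]; exists a => //; rewrite e.
Qed.

Lemma narrow_small (A : set I) : narrow A -> small A.
Proof. by move=> nA; exists A, some; split=> // x Ax; exists x. Qed.

Lemma small_not_onto V (X : set V) (f : V -> I) :
  small X -> exists i, forall x, X x -> f x <> i.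
Proof.
move=> [A [phi [cov nA]]].
have [i hi] := nA (fun a => if phi a is Some x then f x else a).
by exists i => x /cov[a Aa e]; have := hi _ Aa; rewrite e.
Qed.

Lemma small_narrow (A : set I) : small A -> narrow A.
Proof. by move=> sA f; exact: small_not_onto. Qed.

Lemma setT_not_small : ~ small [set: I].
Proof. by move=> sI; have [i /(_ i Logic.I)] := small_not_onto id sI. Qed.

(** With kappa = |I|, the three hypotheses say that kappa^{<kappa} and kappa^2 are at most kappa and
    that kappa is uncountable. The first two are phrased as surjective codings by elements of
    [I]. *)
Hypothesis powI : forall A : set I, narrow A ->
  exists e : I -> I -> I, forall f : I -> I, exists i, forall a, A a -> e i a = f a.
Hypothesis prodI : exists e : I -> I * I, forall p, exists i, e i = p.
Hypothesis natI : small [set: nat].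

(* Koenig's argument: |I|^|X| = |I| makes |I| regular. *)
Lemma small_bigcup V W (X : set V) (F : V -> set W) :
  small X -> (forall x, X x -> small (F x)) -> small (\bigcup_(x in X) F x).
Proof.
move=> [A [phi [cov nA]]] sF.
have /choice[B /choice[psi hB]] : forall a, exists (B : set I) (psi : I -> option W),
    (forall x y, phi a = Some x -> X x -> F x y -> exists2 b, B b & psi b = Some y)
    /\ narrow B.
  move=> a; have [[x [e Xx]]|nx] := pselect (exists x, phi a = Some x /\ X x).
    have [B [psi [cB nB]]] := sF _ Xx; exists B, psi; split=> // x' y.
    by rewrite e => -[<-] _; exact: cB.
  exists A, (fun=> None); split=> // x y e Xx; by case: nx; exists x.
have [e eP] := prodI; have [pe peK] := choice eP.
exists [set i | exists a b, [/\ A a, B a b & i = pe (a, b)]].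
exists (fun i => psi (e i).1 (e i).2); split.
  move=> y [x Xx Fxy]; have [a Aa ea] := cov _ Xx.
  have [b Bb eb] := (hB a).1 _ _ ea Xx Fxy.
  by exists (pe (a, b)); [exists a, b|rewrite peK].
move=> f; apply: contrapT => nf.
have {}nf i : exists a b, [/\ A a, B a b & f (pe (a, b)) = i].
  apply: contrapT => ni; apply: nf; exists i => k [a [b [Aa Bb ->]]] fk.
  by apply: ni; exists a, b.
have [d dP] := powI nA.
(* Diagonalization: [v a] is missed by all functions coded by some [f (pe (a, b))] with [b] in
   [B a]. As [f] is supposed to be onto, a code of [v] itself has this form for some [a], a
   contradiction. *)
have /choice[v vP] : forall a, exists i, forall b, B a b -> d (f (pe (a, b))) a <> i.
  by move=> a; exact: (hB a).2.
have [i di] := dP v; have [a [b [Aa Bb fi]]] := nf i.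
by apply: (vP a b Bb); rewrite fi di.
Qed.

Lemma small_nat_bigcup V (F : nat -> set V) :
  (forall n, small (F n)) -> small (\bigcup_n F n).
Proof. by move=> sF; apply: small_bigcup natI _ => n _. Qed.

Lemma small1 V (x : V) : small [set x].
Proof. by apply: sub_small (small_image (fun=> x) natI) => y ->; exists 0. Qed.

Lemma smallU V (X Y : set V) : small X -> small Y -> small (X `|` Y).
Proof.
move=> sX sY; apply: (@sub_small _ _ (\bigcup_n (if n is 0 then X else Y))).
  by move=> x [Xx|Yx]; [exists 0|exists 1].
by apply: small_nat_bigcup; case.
Qed.

Lemma small_image2 V W U (f : V -> W -> U) (X : set V) (Y : set W) :
  small X -> small Y -> small [set u | exists x y, [/\ X x, Y y & u = f x y]].
Proof.
move=> sX sY; apply: (@sub_small _ _ (\bigcup_(x in X) (f x @` Y))).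
  by move=> _ [x [y [Xx Yy ->]]]; exists x => //; exists y.
by apply: small_bigcup => // x _; exact: small_image.
Qed.

(** An arbitrary well-order [R] already works unless some strict segment is not small. Otherwise
    take the least such [x]: its strict segment maps onto [I], and [R] is pulled back along a right
    inverse [g] of this map. The new segments are small because [g] takes values below [x]. *)
Lemma exists_initial_order : exists le : rel I,
  wochoice.well_order le /\ forall i, small [set j | le j i].
Proof.
have [R woR] := @well_ordering_principle {classic I}.
have small_le x : small [set y | R y x /\ y <> x] -> small [set y | R y x].
  move=> sx; apply: (sub_small _ (smallU sx (small1 x))) => y /= Ryx.
  by have [->|n] := pselect (y = x); [right|left].
have [all_small|/existsNP[x0 nx0]] :=
    pselect (forall x, small [set y | R y x /\ y <> x]).
  by exists R; split=> // i; exact: small_le.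
have [|x nx xm] := wo_minimum woR (P := [set x | ~ small [set y | R y x /\ y <> x]]).
  by exists x0.
have seg_small y : R y x -> y <> x -> small [set z | R z y].
  move=> Ryx nyx; apply: small_le; apply: contrapT => ny.
  by apply: nyx; apply: (wo_anti woR) => //; exact: xm.
have [f fP] : exists f : I -> I, forall i, exists a, [/\ R a x, a <> x & f a = i].
  apply: contrapT => nf; apply: nx; apply: narrow_small => f.
  apply: contrapT => ni; apply: nf; exists f => i.
  apply: contrapT => na; apply: ni; exists i => a [Rax nax] fa.
  by apply: na; exists a.
have [g gP] := choice fP.
have gK i : f (g i) = i by case: (gP i).
exists (fun i j => R (g i) (g j)); split.
  apply: antisymmetric_well_order.
    by move=> i j /andP[ij ji]; rewrite -(gK i) (wo_anti woR ij ji) gK.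
  move=> A [i Ai]; have [|_ [j Aj ->] jm] :=
    wo_minimum woR (P := [set y | exists2 i, i \in A & y = g i]).
    by exists (g i), i.
  by exists j; split=> // k Ak; apply: jm; exists k.
move=> i; have [gx ngx _] := gP i.
apply: (sub_small _ (small_image f (seg_small _ gx ngx))) => j /= ji.
by exists (g j).
Qed.

Variable le : rel I.
Hypothesis wo : wochoice.well_order le.
Hypothesis seg_small : forall i, small [set j | le j i].

(** Regularity of |I|: if [A] had no upper bound, [I] would be a small union of small segments. *)
Lemma small_bounded (A : set I) : small A -> exists k, forall a, A a -> le a k.
Proof.
move=> sA; apply: contrapT => nk; apply: setT_not_small.
apply: (sub_small _ (small_bigcup sA (fun a _ => seg_small a))) => k _.
apply: contrapT => nA; apply: nk; exists k => a Aa.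
by case: (wo_total wo a k) => // ka; case: nA; exists a.
Qed.

Lemma lt_seg_small i : small [set j | le j i /\ j <> i].
Proof. by apply: sub_small (seg_small i) => j []. Qed.

Definition enumerated V (C : set V) := exists e : I -> V, forall v, C v -> exists i, e i = v.

Lemma enumerated_prod V W (C : set V) (D : set W) :
  enumerated C -> enumerated D -> enumerated (C `*` D).
Proof.
move=> [e eP] [d dP]; have [p pP] := prodI.
exists (fun i => (e (p i).1, d (p i).2)) => -[v w] [/= /eP[i <-] /dP[j <-]].
by have [k pk] := pP (i, j); exists k; rewrite pk.
Qed.

(** Small subsets of [I] are bounded, so a small [S] is the image of some segment under a map into
    [C]. It is coded by the end [k] of the segment and a code of the map. Images of segments are
    nonempty, which explains the restriction to nonempty [S]. *)
Lemma enumerated_small V (C : set V) : enumerated C ->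
  enumerated [set S | [/\ S !=set0, S `<=` C & small S]].
Proof.
move=> [s sP]; have /choice[d dP] := fun k => powI (small_narrow (seg_small k)).
have [p pP] := prodI.
exists (fun i => [set v | exists2 a, le a (p i).1 & v = s (d (p i).1 (p i).2 a)]).
move=> S [[v0 Sv0] SC [A [phi [cov nA]]]].
have [k kP] := small_bounded (narrow_small nA).
(* Indices that code no element of [S] are sent to the element [v0] of [S], so that the image is
   exactly [S]. *)
have /choice[psi psiP] : forall a, exists i, S (s i) /\
    (forall v, phi a = Some v -> S v -> s i = v).
  move=> a; have [[v [ea Sv]]|nv] := pselect (exists v, phi a = Some v /\ S v).
    have [i si] := sP _ (SC _ Sv); exists i; split; first by rewrite si.
    by move=> w; rewrite ea => -[<-].
  have [i si] := sP _ (SC _ Sv0); exists i; split; first by rewrite si.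
  by move=> w ew Sw; case: nv; exists w.
have [j dj] := dP k psi; have [i pi] := pP (k, j); exists i; rewrite pi /=.
apply/seteqP; split=> v /=.
  by move=> [a ak ->]; rewrite dj //; case: (psiP a).
move=> Sv; have [a Aa ea] := cov _ Sv.
exists a; first exact: kP.
by rewrite dj ?(proj2 (psiP a) _ ea) //; exact: kP.
Qed.

(** Enumerate the pairs [(i, v)] with [i] in [I]. The indices up to [k] are too few to exhaust the
    first coordinates, so some pair with second coordinate [v] appears only after [k]. *)
Lemma enumerated_recurring V (C : set V) : enumerated C ->
  exists e : I -> V, forall v k, C v -> exists2 i, le k i & e i = v.
Proof.
move=> eC; have eI : enumerated [set: I] by exists id => v _; exists v.
have [d dP] := enumerated_prod eI eC.
exists (fun i => (d i).2) => v k Cv; apply: contrapT => nk.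
have [i iP] := small_not_onto (fun t => (d t).1) (seg_small k).
have [//|t dt] := dP (i, v); apply: (iP t); rewrite ?dt //=.
case: (wo_total wo t k) => // kt; case: nk; exists t => //; by rewrite dt.
Qed.

End Small.

(** * Small sets in terms of cardinal inequalities *)

Lemma card_le_injP V W (A : set V) (B : set W) :
  A #<= B <-> exists f : A -> B, injective f.
Proof.
split=> [/card_leP[f]|[f fi]].
  by exists f => x y; apply: (@inj _ _ _ f); rewrite inE.
by apply/card_leP/injfunPex; exists f => // x y _ _; exact: fi.
Qed.

(** From right to left, an injection of [A] into [B] has narrow range: a map of its range onto [B]
    would, by choosing preimages, embed [B] into [A]. *)
Lemma smallP W (B : set W) V (A : set V) : small B A <-> A #< B.
Proof.
split=> [sA|[/card_le_injP[j j_inj] nBA]].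
  have [A0 [phi [cov nA0]]] := sA; split.
    have /choice[f fP] : forall x : A, exists a, phi a = Some (val x).
      by move=> x; have [a _ e] := cov _ (set_valP x); exists a.
    by apply/card_le_injP; exists f => x y e; apply/val_inj/Some_inj; rewrite -!fP e.
  move=> /card_le_injP[j j_inj]; have [b0 _] := nA0 id.
  have /choice[f fP] : forall x, exists i, forall i', val (j i') = x -> i = i'.
    move=> x; have [[i ji]|ni] := pselect (exists i, val (j i) = x).
      by exists i => i'; rewrite -ji => /val_inj/j_inj.
    by exists b0 => i' ji'; case: ni; exists i'.
  have [i iP] := small_not_onto f sA.
  by apply: (iP (val (j i))); [exact: set_valP|exact: fP].
exists (range j), (fun b => if pselect (exists a, j a = b) is left h
                            then Some (val (projT1 (cid h))) else None).
split.
  move=> x Ax; pose a : A := exist _ x (mem_set Ax).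
  exists (j a); first by exists a.
  case: pselect => [h|[]]; last by exists a.
  by case: cid => a' /= /j_inj ->.
move=> f; apply: contrapT => nf; apply: nBA.
have /choice[g gP] : forall b, exists a, f (j a) = b.
  move=> b; apply: contrapT => na; apply: nf; exists b => _ [a _ <-] fa.
  by apply: na; exists a.
by apply/card_le_injP; exists g => b b' e; rewrite -(gP b) e gP.
Qed.

Lemma small_card_le W (B : set W) V U (X : set V) (Y : set U) :
  X #<= Y -> small B Y -> small B X.
Proof.
move=> XY /smallP[YB nBY]; apply/smallP; split; first exact: card_le_trans YB.
by move=> BX; apply: nBY; exact: card_le_trans XY.
Qed.

Lemma small_set_type W (B : set W) V (X : set V) : small B X -> small B [set: X].
Proof. by apply: small_card_le; have := card_setT X; rewrite card_eq_le => /andP[]. Qed.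

Section WeakPower.
Variables (W : Type) (B : set W).
Hypothesis B_pow : is_weak_power B B.
Hypothesis B_nat : small B [set: nat].

Lemma weak_power_onto X : small B [set: X] ->
  exists e : B -> X -> B, forall f, exists i, e i = f.
Proof.
move=> /smallP/(proj1 B_pow)/card_le_injP[j j_inj].
pose j' f := j (exist _ f (mem_set Logic.I : f \in [set: X -> B])).
have j'_inj : injective j' by move=> f g /j_inj[].
exists (fun b => if pselect (exists f, j' f = b) is left h
                 then projT1 (cid h) else fun=> b) => f.
exists (j' f); case: pselect => [h|[]]; last by exists f.
by case: cid => g /= /j'_inj.
Qed.

Lemma weak_power_fun (A : set B) : narrow A ->
  exists e : B -> B -> B, forall f : B -> B, exists i, forall a, A a -> e i a = f a.
Proof.
move=> /narrow_small/small_set_type/weak_power_onto[e eP].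
exists (fun i a => if pselect (A a) is left h then e i (exist _ a (mem_set h)) else a).
move=> f; have [i ei] := eP (f \o val); exists i => a Aa.
by case: pselect => // h; rewrite ei.
Qed.

(** This is kappa^{<kappa} = kappa for an exponent with two elements. *)
Lemma weak_power_prod : exists e : B -> B * B, forall p, exists i, e i = p.
Proof.
have [|e eP] := @weak_power_onto bool.
  by apply: sub_small (small_image odd B_nat) => -[] _; [exists 1|exists 0].
exists (fun i => (e i true, e i false)) => -[a b].
by have [i ei] := eP (fun c => if c then a else b); exists i; rewrite ei.
Qed.
End WeakPower.

Lemma card_le_enumerated W (B : set W) V (v0 : V) (A : set V) :
  A #<= B -> enumerated B A.
Proof.
move=> /card_le_injP[j j_inj].
exists (fun b => if pselect (exists a, j a = b) is left h then val (projT1 (cid h)) else v0).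
move=> v Av; pose a : A := exist _ v (mem_set Av); exists (j a).
case: pselect => [h|[]]; last by exists a.
by case: cid => a' /= /j_inj ->.
Qed.
(** * Strong subsets of a model *)

Section AutAction.
Variables (L : language) (T : Type) (M : structure L T).
Implicit Types (g h : aut M) (D : set T).

Lemma autM g h x : (g * h)%g x = g (h x). Proof. by []. Qed.
Lemma autK g x : (g^-1)%g (g x) = x. Proof. exact: (aut_Kinv g x). Qed.
Lemma autKV g x : g ((g^-1)%g x) = x. Proof. exact: (aut_invK g x). Qed.
Lemma aut_inj g : injective g. Proof. exact: can_inj (autK g). Qed.

(** The equivalence, rather than a single implication, makes [g] restrict to a permutation of
    [D]. *)
Definition stable D g := forall x, D (g x) <-> D x.

Lemma stableM D g h : stable D g -> stable D h -> stable D (g * h)%g.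
Proof. by move=> sg sh x; rewrite autM (sg _) (sh _). Qed.

Lemma stableV D g : stable D g -> stable D (g^-1)%g.
Proof. by move=> sg x; rewrite -{2}[x](autKV g) (sg _). Qed.

(** If [h x] lies in [D], so does its preimage under [g]. There [g] and [h] agree, so injectivity of
    [h] identifies this preimage with [x]. *)
Lemma eq_stable D g h : (forall x, D x -> g x = h x) -> stable D g -> stable D h.
Proof.
move=> gh sg x; split=> [Dhx|Dx]; last by rewrite -gh //; exact/sg.
have Dy : D ((g^-1)%g (h x)) by exact/(stableV sg).
by have /aut_inj <- : h ((g^-1)%g (h x)) = h x by rewrite -gh // autKV.
Qed.

Lemma image_autE D g x : (g @` D) x <-> D ((g^-1)%g x).
Proof.
by split=> [[y Dy <-]|Dx]; [rewrite autK|exists ((g^-1)%g x); rewrite ?autKV].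
Qed.

Lemma stable_conj D g h : stable D g -> stable (h @` D) (h * (g * h^-1))%g.
Proof. by move=> sg x; rewrite !image_autE !autM autK (sg _). Qed.

Lemma aut_of_isom f : isomorphism M M f -> exists g, forall x, dom M x -> g x = f x.
Proof.
move=> [[f1 f2 f3] ff fr]; pose f' x := if pselect (dom M x) then f x else x.
have f'E x : dom M x -> f' x = f x by rewrite /f'; case: pselect.
have f'c n (x : 'I_n -> T) : (forall i, dom M (x i)) -> f' \o x = f \o x.
  by move=> Mx; apply: funext => i /=; rewrite f'E.
have f'i : isomorphism M M f'.
  split.
  - split.
    + by move=> x Mx; rewrite f'E //; exact: f1.
    + move=> x y Mx My; rewrite !f'E; [exact: f2|exact: set_mem My|exact: set_mem Mx].
    + by move=> y /f3[x Mx <-]; exists x => //; rewrite f'E.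
  - by move=> s x Mx; rewrite (f'E _ (fint_dom Mx)) (f'c _ _ Mx) (ff _ _ Mx).
  - by move=> s x Mx; rewrite (f'c _ _ Mx); exact: fr.
have f'o x : ~ dom M x -> f' x = x by rewrite /f'; case: pselect.
by exists (Aut f'i f'o).
Qed.

Lemma isom_fint g s (x : 'I_(farity s) -> T) :
  (forall i, dom M (x i)) -> g (fint M s x) = fint M s (g \o x).
Proof. by case: (aut_isom g) => _ gf _; exact: gf. Qed.

End AutAction.

Section Strong.
Variables (L : language) (K : ordered_class L) (T : Type) (M : structure L T).
Hypothesis hK : is_AEC K.
Implicit Types (N : structure L T) (D : set T) (g h : aut M).

(** Strong submodels are represented by their universes: on its universe, such a submodel inherits
    its interpretations from [M]. *)
Definition strong D := exists2 N, prec K N M & dom N = D.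

Lemma substructure_refl N : substructure N N. Proof. by split. Qed.

Lemma strong_sub D : strong D -> D `<=` dom M.
Proof. by move=> [N /(prec_sub hK)[NM _ _] <-]. Qed.

Lemma strong_neq0 D : strong D -> D !=set0.
Proof. by move=> [N _ <-]; exact: dom_neq0. Qed.

Lemma strong_fint D s (x : 'I_(farity s) -> T) :
  strong D -> (forall i, D (x i)) -> D (fint M s x).
Proof.
move=> [N /(prec_sub hK)[NM Nf _] <-] Nx; rewrite -Nf //; exact: fint_dom.
Qed.

Lemma substructure_isom N1 N2 (f : T -> T) :
  substructure N1 M -> substructure N2 M -> set_bij (dom N1) (dom N2) f ->
  (forall s (x : 'I_(farity s) -> T),
     (forall i, dom N1 (x i)) -> f (fint M s x) = fint M s (f \o x)) ->
  (forall s (x : 'I_(rarity s) -> T),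
     (forall i, dom N1 (x i)) -> (rint M s x <-> rint M s (f \o x))) ->
  isomorphism N1 N2 f.
Proof.
move=> [_ N1f N1r] [_ N2f N2r] fb ff fr; have [f1 _ _] := fb.
split=> // s x Nx.
  by rewrite N1f // ff // N2f // => i; apply: f1; exact: Nx.
by rewrite (N1r _ _ Nx) (fr _ _ Nx) (N2r _ (f \o x)) // => i; apply: f1; exact: Nx.
Qed.

Lemma prec_sub_dom N1 N2 :
  prec K N1 M -> prec K N2 M -> dom N1 `<=` dom N2 -> prec K N1 N2.
Proof.
move=> N1M N2M sub; apply: (coherence hK _ N1M N2M).
have [_ f1 r1] := prec_sub hK N1M; have [_ f2 r2] := prec_sub hK N2M.
split=> // s x Nx.
  by rewrite f1 // f2 // => i; exact/sub/Nx.
by rewrite (r1 _ _ Nx) (r2 s x) // => i; exact/sub/Nx.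
Qed.

Lemma strong_image D g : strong D -> strong (g @` D).
Proof.
move=> [N NM <-]; exists (image_structure N g) => //.
apply: (prec_isom hK (aut_isom g)) NM; split.
- split; [by move=> x Nx; exists x|by move=> x y _ _; exact: aut_inj|by []].
- move=> s x Nx /=; congr (g (fint N s _)); apply: funext => i /=.
  by rewrite autK.
- move=> s x Nx /=; have -> // : (g^-1)%g \o (g \o x) = x.
  by apply: funext => i /=; rewrite autK.
Qed.

Definition restriction D (D0 : D !=set0)
    (Dclosed : forall s (x : 'I_(farity s) -> T),
       (forall i, D (x i)) -> D (fint M s x)) : structure L T :=
  @Structure L T D D0 (fint M) (rint M) Dclosed.

(** * Unions of chains and gluing of automorphisms *)

Section Union.
Variables (J : Type) (le : rel J).
Hypothesis wo : wochoice.well_order le.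
Local Notation lt i j := (le i j /\ i <> j).

(** This is the chain axiom for sets indexed by an initial segment [P] without last element. That
    the union is strong in [M] itself comes from the last clause of [chain_union], applied to the
    upper bound [M]. *)
Lemma strong_continuous_union (P : set J) (E : J -> set T) :
  P !=set0 -> (forall i j, lt j i -> P i -> P j) ->
  (forall i, P i -> exists2 j, P j & lt i j) ->
  (forall i, P i -> strong (E i)) -> (forall i j, le i j -> E i `<=` E j) ->
  (forall i, limit_index le i -> E i `<=` \bigcup_(j in [set j | lt j i]) E j) ->
  strong (\bigcup_(i in P) E i).
Proof.
move=> [p0 Pp0] Plow Pnomax Es mono cont.
pose leP (i j : P) := le (val i) (val j).
have woP : wochoice.well_order leP := @wo_restrict _ _ wo P.
have inP i (Pi : P i) : {j : P | val j = i} by exists (exist _ i (mem_set Pi)).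
have /choice[C CP] : forall i : P, exists N, prec K N M /\ dom N = E (val i).
  by move=> i; have [N] := Es _ (set_valP i); exists N.
have P0 : inhabited P by case: (inP _ Pp0) => i _; constructor; exact: i.
have UE : \bigcup_(i in P) E i = \bigcup_i E (val (i : P)).
  apply/seteqP; split=> x; last by move=> [i _ Ei]; exists (val i) => //; exact: set_valP.
  by move=> [i Pi Ei]; have [j ji] := inP _ Pi; exists j => //; rewrite ji.
have monoP (i j : P) : leP i j -> E (val i) `<=` E (val j) by exact: mono.
have UM : \bigcup_(i in P) E i `<=` dom M.
  by move=> x [i Pi]; apply: (strong_sub (Es _ Pi)).
have U0 : (\bigcup_(i in P) E i) !=set0.
  by have [x Ex] := strong_neq0 (Es _ Pp0); exists x, p0.
have Uf s (x : 'I_(farity s) -> T) : (forall k, (\bigcup_(i in P) E i) (x k)) ->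
    (\bigcup_(i in P) E i) (fint M s x).
  rewrite UE => /(finite_tuple_in_chain woP P0 monoP)[i ix]; exists i => //.
  exact: strong_fint (Es _ (set_valP i)) ix.
exists (restriction U0 Uf) => //.
have [|||_ _ UN] := @chain_union _ _ hK P leP T C (restriction U0 Uf).
- split=> // i; have [j Pj [ij nij]] := Pnomax _ (set_valP i).
  have [k kj] := inP _ Pj; exists k; rewrite /leP kj; split=> // e.
  by apply: nij; rewrite e kj.
- split.
  + by move=> i; have [/(prec_inK hK)[]] := CP i.
  + move=> i j ij; have [Ci di] := CP i; have [Cj dj] := CP j.
    by apply: prec_sub_dom => //; rewrite di dj; exact: monoP.
  + move=> i [[j [ji nji]] lim]; rewrite (proj2 (CP i)); apply/seteqP; split.
      move=> x /cont[|k [ki nki] Ekx].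
        split; first by exists (val j); split=> // /val_inj.
        move=> k [ki nki].
        have [k' k'k] := inP _ (Plow _ _ (conj ki nki) (set_valP i)).
        have [|l [[k'l nk'l] [li nli]]] := lim k'.
          by rewrite /leP k'k; split=> // e; apply: nki; rewrite -e k'k.
        exists (val l); rewrite -k'k.
        by split; split=> // /val_inj.
      have [k' k'k] := inP _ (Plow _ _ (conj ki nki) (set_valP i)).
      exists k'; last by rewrite (proj2 (CP k')) k'k.
      by rewrite /= /leP k'k; split=> // e; apply: nki; rewrite -e k'k.
    by move=> x [k [ki _]]; rewrite (proj2 (CP k)); exact: mono.
- split; first by rewrite /= UE; apply: eq_bigcupr => i _; rewrite (proj2 (CP i)).
  move=> i; have [Ci di] := CP i; have [_ f1 r1] := prec_sub hK Ci.
  split=> //= x; rewrite di => Ex; rewrite UE; by exists i.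
- by apply: UN => i; case: (CP i).
Qed.

(* [chain_union] is about continuous chains; an arbitrary chain is made
   continuous by taking the unions of its initial segments. *)
Lemma strong_union (D : J -> set T) :
  inhabited J -> (forall i, strong (D i)) -> (forall i j, le i j -> D i `<=` D j) ->
  strong (\bigcup_i D i).
Proof.
move=> [j0] Ds mono; have [|m _ mm] := wo_minimum wo (P := setT); first by exists j0.
(* Adding [D m] keeps [E i] nonempty at the least index, where the union over earlier indices is
   empty. *)
pose E i := D m `|` \bigcup_(j in [set j | lt j i]) D j.
have Emono i j : le i j -> E i `<=` E j.
  move=> ij x [Dx|[k [ki nki] Dx]]; first by left.
  right; exists k => //; split; first exact: wo_trans ij.
  by move=> e; apply: nki; apply: (wo_anti wo) => //; rewrite e.
have Econt i : limit_index le i -> E i `<=` \bigcup_(j in [set j | lt j i]) E j.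
  move=> [[j ji] lim] x [Dx|[k ki Dx]]; first by exists j => //; left.
  by have [l [kl li]] := lim _ ki; exists l => //; right; exists k.
have lt_trans i j k : lt i j -> lt j k -> lt i k.
  move=> [ij nij] [jk njk]; split; first exact: wo_trans jk.
  by move=> e; apply: njk; apply: (wo_anti wo) => //; rewrite -e.
have Es i : strong (E i).
  elim/(wo_ind wo): i => i IH.
  (* At the least index and at successors, [E i] is one of the sets [D k]. At limits it is the union
     of the earlier [E j], and the continuous case applies by induction. *)
  have [[j ji]|ni] := pselect (exists j, lt j i); last first.
    have -> // : E i = D m; apply/seteqP; split=> [x [//|[k ki]]|x]; last by left.
    by case: ni; exists k.
  have [[k [ki kmax]]|nk] := pselect (exists k, lt k i /\ forall l, lt l i -> le l k).
    have -> // : E i = D k; apply/seteqP; split=> x.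
      by move=> [|[l /kmax lk]]; apply: mono => //; exact: mm.
    by move=> Dx; right; exists k.
  have nomax l : lt l i -> exists2 k, lt k i & lt l k.
    move=> li; apply: contrapT => nl; apply: nk; exists l; split=> // k ki.
    apply: contrapT => kl; apply: nl; exists k => //.
    by have [lk nlk] := wo_not_le wo kl.
  have -> : E i = \bigcup_(j in [set j | lt j i]) E j.
    apply/seteqP; split=> [x [Dx|[k ki Dx]]|x [k [ki _]]].
    - by exists j => //; left.
    - by have [l li kl] := nomax _ ki; exists l => //; right; exists k.
    - exact: Emono.
  apply: strong_continuous_union => //; first by exists j.
    by move=> a b ba ai; exact: lt_trans ba ai.
  by move=> k [ki nki]; exact: IH.
have [[k kmax]|nk] := pselect (exists k, forall l, le l k).
  have -> // : \bigcup_i D i = D k; apply/seteqP; split=> [x [l _]|x Dx]; last by exists k.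
  exact: mono.
have nomax l : exists k, lt l k.
  apply: contrapT => nl; apply: nk; exists l => k; apply: contrapT => kl.
  by apply: nl; exists k; exact: wo_not_le.
have -> : \bigcup_i D i = \bigcup_(i in setT) E i.
  apply/seteqP; split=> [x [l _ Dx]|x [i _ [Dx|[k _ Dx]]]].
  - by have [k lk] := nomax l; exists k => //; right; exists l.
  - by exists m.
  - by exists k.
by apply: strong_continuous_union => // [|i _]; [exists m|have [k] := nomax i; exists k].
Qed.

(** Coherence defines the common extension [f]; preservation of each symbol is checked at a stage
    containing the whole tuple. *)
Lemma glue_isom (D : J -> set T) (h : J -> aut M) N1 N2 : inhabited J ->
  (forall i, strong (D i)) -> (forall i j, le i j -> D i `<=` D j) ->
  (forall i j x, le i j -> D i x -> h j x = h i x) ->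
  substructure N1 M -> substructure N2 M ->
  dom N1 = \bigcup_i D i -> dom N2 = \bigcup_i h i @` D i ->
  exists2 f, isomorphism N1 N2 f & forall i x, D i x -> f x = h i x.
Proof.
move=> J0 Ds mono coh N1M N2M d1 d2.
have coh' i j x : D i x -> D j x -> h i x = h j x.
  move=> Di Dj; case: (wo_total wo i j) => [ij|ji]; first by rewrite (coh _ _ _ ij Di).
  by rewrite (coh _ _ _ ji Dj).
have /choice[f fP] : forall x, exists y, forall i, D i x -> y = h i x.
  move=> x; have [[i Di]|ni] := pselect (exists i, D i x).
    by exists (h i x) => j Dj; exact: coh'.
  by exists x => i Di; case: ni; exists i.
have fE i x : D i x -> f x = h i x by exact: fP.
exists f => //; apply: substructure_isom => //.
- split; rewrite d1 ?d2.
  + by move=> x [i _ Di]; exists i => //; exists x => //; rewrite (fE _ _ Di).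
  + move=> x y /set_mem[i _ Di] /set_mem[j _ Dj].
    have [ij|ji] := wo_total wo i j.
      by rewrite (fE _ _ (mono _ _ ij _ Di)) (fE _ _ Dj); exact: aut_inj.
    by rewrite (fE _ _ Di) (fE _ _ (mono _ _ ji _ Dj)); exact: aut_inj.
  + by move=> _ [i _ [x Di <-]]; exists x; [exists i|exact: fE].
- move=> s x; rewrite d1 => /(finite_tuple_in_chain wo J0 mono)[i ix].
  rewrite (fE i) ?isom_fint; last exact: strong_fint.
    by congr fint; apply: funext => k /=; rewrite (fE i).
  by move=> k; apply: strong_sub (Ds i) _ (ix k).
- move=> s x; rewrite d1 => /(finite_tuple_in_chain wo J0 mono)[i ix].
  have -> : f \o x = h i \o x by apply: funext => k /=; rewrite (fE i).
  have [_ _ hr] := aut_isom (h i); apply: hr => k.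
  by apply: strong_sub (Ds i) _ (ix k).
Qed.

Lemma glue_aut (D : J -> set T) (h : J -> aut M) : inhabited J ->
  (forall i, strong (D i)) -> (forall i j, le i j -> D i `<=` D j) ->
  (forall i j x, le i j -> D i x -> h j x = h i x) ->
  \bigcup_i D i = dom M -> \bigcup_i h i @` D i = dom M ->
  exists g : aut M, forall i x, D i x -> g x = h i x.
Proof.
move=> J0 Ds mono coh d1 d2.
have [f /aut_of_isom[g gP] fP] := glue_isom J0 Ds mono coh
  (substructure_refl M) (substructure_refl M) (esym d1) (esym d2).
exists g => i x Dx; rewrite gP; first exact: fP.
exact: strong_sub (Ds i) _ Dx.
Qed.

End Union.
End Strong.

(** * Small strong submodels: hulls, homogeneity and amalgamation *)

Section Good.
Variables (L : language) (K : ordered_class L) (T : Type) (M : structure L T).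
Variable LS : Type.
Hypothesis hK : is_AEC K.
Hypothesis hM : inK K M.
Hypothesis hLS : LS_bound K LS.
Hypothesis hkappa : [set: LS] #< dom M.
Hypothesis hpow : is_weak_power (dom M) (dom M).
Hypothesis hhom : homogeneous K M.
Hypothesis hamalg : strong_amalgamation_class K M.
Implicit Types (N : structure L T) (D : set T) (g h : aut M).

Lemma kappa_nat : small (dom M) [set: nat].
Proof.
have [LSn _] := hLS; have /smallP := hkappa; apply: small_card_le.
apply: card_le_trans LSn; apply/card_leP/injfunPex.
pose f (n : [set: nat]) := exist (fun x => x \in [set: (Defs.fsym L + Defs.rsym L + nat)%type])
  (inr (val n)) (mem_set Logic.I).
by exists f => // x y _ _ [/val_inj].
Qed.

Let Mfun := weak_power_fun hpow.
Let Mprod := weak_power_prod hpow kappa_nat.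
Let bigcup_small := small_bigcup Mfun Mprod.
Let U_small := smallU Mfun Mprod kappa_nat.

Definition good D := strong K M D /\ small (dom M) D.

Lemma good_sub D : good D -> D `<=` dom M.
Proof. by move=> [/(strong_sub hK)]. Qed.

Lemma good_small_sub D : good D -> exists2 N, small_sub K M N & dom N = D.
Proof. by move=> [[N NM <-] /smallP]; exists N. Qed.

Lemma small_sub_good N : small_sub K M N -> good (dom N).
Proof. by move=> [NM /smallP]; split=> //; exists N. Qed.

Lemma good_image D g : good D -> good (g @` D).
Proof. by move=> [sD smD]; split; [exact: strong_image|exact: small_image]. Qed.

Lemma good_hull (A : set T) : small (dom M) A -> A `<=` dom M ->
  exists2 D, good D & A `<=` D.
Proof.
move=> sA AM; have [_ /(_ T M A hM AM)[N [NM AN Ncard]]] := hLS.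
exists (dom N) => //; split; first by exists N.
apply: small_card_le Ncard _.
have sAT := small_image (@inl A LS) (small_set_type sA).
have sLS := small_image (@inr A LS) (proj2 (smallP _ _) hkappa).
apply: sub_small (U_small sAT sLS).
by move=> [a|b] _; [left; exists a|right; exists b].
Qed.

(** Starting from a hull of [A], iterate countably often the passage to a hull of the set together
    with its images under all [g v] and their inverses. The union stays small because kappa is
    regular and uncountable. *)
Lemma good_closure V (X : set V) (g : V -> aut M) (A : set T) :
  small (dom M) X -> small (dom M) A -> A `<=` dom M ->
  exists D, [/\ good D, A `<=` D & forall v, X v -> stable D (g v)].
Proof.
move=> sX sA AM; have [D0 gD0 AD0] := good_hull sA AM.
have /choice[nx nxP] : forall D, exists D', good D -> [/\ good D', D `<=` D' &
    forall v x, X v -> D x -> D' (g v x) /\ D' ((g v)^-1%g x)].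
  move=> D; have [gD|nD] := pselect (good D); last by exists D.
  have [||D' gD' DD'] := @good_hull (D `|` \bigcup_(v in X)
      (g v @` D `|` (g v)^-1%g @` D)).
  - apply: U_small; first exact: gD.2.
    by apply: bigcup_small => // v _; apply: U_small; exact: small_image gD.2.
  - move=> x [/(good_sub gD)//|[v _ [|]]].
      by move=> [y Dy <-]; apply: aut_dom; exact: good_sub gD _ Dy.
    by move=> [y Dy <-]; apply: aut_dom; exact: good_sub gD _ Dy.
  - exists D' => _; split=> // [x Dx|v x Xv Dx]; first by apply: DD'; left.
    by split; apply: DD'; right; exists v => //; [left|right]; exists x.
pose Dn n := iter n nx D0.
have gDn n : good (Dn n) by elim: n => // n IH; case: (nxP _ IH).
have mono m n : (m <= n)%N -> Dn m `<=` Dn n.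
  move=> /subnK<-; elim: (n - m)%N => // k IH x /IH; rewrite addSn.
  by case: (nxP _ (gDn (k + m)%N)) => _ + _; apply.
exists (\bigcup_n Dn n); split.
- split; first by apply: (strong_union hK wo_leq (inhabits 0)) => // n; exact: (gDn n).1.
  by apply: bigcup_small kappa_nat _ => n _; exact: (gDn n).2.
- by move=> x /AD0 Dx; exists 0.
- move=> v Xv x; split=> -[n _ Dx].
    exists n.+1 => //; have [_ _ /(_ v _ Xv Dx)[_]] := nxP _ (gDn n).
    by rewrite autK.
  by exists n.+1 => //; have [_ _ /(_ v _ Xv Dx)[]] := nxP _ (gDn n).
Qed.

Lemma good_union J (le : rel J) (D : J -> set T) :
  wochoice.well_order le -> inhabited J -> small (dom M) [set: J] ->
  (forall i, good (D i)) -> (forall i j, le i j -> D i `<=` D j) ->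
  good (\bigcup_i D i).
Proof.
move=> wo J0 sJ gD mono; split; first by apply: (strong_union hK wo) => // i; exact: (gD i).1.
by apply: bigcup_small => // i _; exact: (gD i).2.
Qed.

(** Gluing alone yields an isomorphism between two small strong submodels; homogeneity extends it to
    an automorphism of [M]. *)
Lemma good_glue J (le : rel J) (D : J -> set T) (h : J -> aut M) :
  wochoice.well_order le -> inhabited J -> small (dom M) [set: J] ->
  (forall i, good (D i)) -> (forall i j, le i j -> D i `<=` D j) ->
  (forall i j x, le i j -> D i x -> h j x = h i x) ->
  exists g : aut M, forall i x, D i x -> g x = h i x.
Proof.
move=> wo J0 sJ gD mono coh.
have [N1 sN1 d1] := good_small_sub (good_union wo J0 sJ gD mono).
have [|N2 sN2 d2] := @good_small_sub (\bigcup_i h i @` D i).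
  apply: (good_union wo) => // [i|i j ij _ [x Dx <-]]; first exact: good_image.
  by exists x; [exact: mono Dx|rewrite (coh _ _ _ ij Dx)].
have [f fi fP] := glue_isom hK wo J0 (fun i => (gD i).1) mono coh
  (prec_sub hK sN1.1) (prec_sub hK sN2.1) d1 d2.
have [g gP] := hhom sN1 sN2 fi; exists g => i x Dx.
by rewrite gP ?(fP i) // d1; exists i.
Qed.

(** Together with [extend_aut], this translates between automorphisms of a small strong submodel, as
    used in strong amalgamation, and automorphisms of [M] that stabilize its universe. *)
Lemma restrict_aut N g : prec K N M -> stable (dom N) g ->
  exists c : aut N, forall x, dom N x -> c x = g x.
Proof.
move=> NM sg; apply: aut_of_isom; have NsM := prec_sub hK NM; have [Nd _ _] := NsM.
apply: (substructure_isom NsM NsM).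
- split; [by move=> x /sg|by move=> x y _ _; exact: aut_inj|].
  by move=> x Nx; exists ((g^-1)%g x); [exact/(stableV sg)|exact: autKV].
- by move=> s x Nx; apply: isom_fint => i; exact/Nd/Nx.
- by move=> s x Nx; have [_ _ gr] := aut_isom g; apply: gr => i; exact/Nd/Nx.
Qed.

Lemma extend_aut N (c : aut N) : small_sub K M N ->
  exists2 g : aut M, stable (dom N) g & forall x, dom N x -> g x = c x.
Proof.
move=> sN; have [g gP] := hhom sN sN (aut_isom c); exists g => // x.
split=> [Ngx|Nx]; last by rewrite gP //; exact: aut_dom.
have [[_ _ cs] _ _] := aut_isom c; have [y Ny cy] := cs _ Ngx.
by rewrite -(gP _ Ny) in cy; rewrite -(aut_inj cy).
Qed.

(** This is strong amalgamation for automorphisms of [M], normalized so that [D1] stays in place and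
    only [D2] is moved. *)
Lemma amalgamation J (S : set J) D0 D1 D2 (x1 x2 : J -> aut M) :
  small (dom M) S -> good D0 -> good D1 -> good D2 -> D0 `<=` D1 -> D0 `<=` D2 ->
  (forall j, S j -> [/\ stable D0 (x1 j), stable D1 (x1 j), stable D2 (x2 j) &
     forall m, D0 m -> x1 j m = x2 j m]) ->
  exists (D3 : set T) (b : aut M) (x3 : J -> aut M),
    [/\ good D3, D1 `<=` D3, pw_stab D0 b, (forall m, D2 m -> D3 (b m)) &
     forall j, S j -> [/\ stable D3 (x3 j), (forall m, D1 m -> x3 j m = x1 j m) &
       forall m, D2 m -> x3 j (b m) = b (x2 j m)]].
Proof.
move=> sS /good_small_sub[N0 sN0 <-] /good_small_sub[N1 sN1 <-].
move=> /good_small_sub[N2 sN2 <-] D01 D02 xP.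
have /choice[c0 c0P] : forall j : S, exists c : aut N0,
    forall x, dom N0 x -> c x = x1 (val j) x.
  by move=> j; apply: restrict_aut sN0.1 _; have [] := xP _ (set_valP j).
have /choice[c1 c1P] : forall j : S, exists c : aut N1,
    forall x, dom N1 x -> c x = x1 (val j) x.
  by move=> j; apply: restrict_aut sN1.1 _; have [] := xP _ (set_valP j).
have /choice[c2 c2P] : forall j : S, exists c : aut N2,
    forall x, dom N2 x -> c x = x2 (val j) x.
  by move=> j; apply: restrict_aut sN2.1 _; have [] := xP _ (set_valP j).
have Sk : [set: S] #< dom M by apply/smallP/small_set_type.
have [] := hamalg sN0 Sk (c := c0) sN1 sN2 _ _ (c1 := c1) (c2 := c2).
- by apply: prec_sub_dom sN0.1 sN1.1 D01.
- by apply: prec_sub_dom sN0.1 sN2.1 D02.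
- by move=> j x Nx; rewrite c1P ?c0P //; exact: D01.
- move=> j x Nx; rewrite c2P ?c0P //; last exact: D02.
  by have [_ _ _ ->] := xP _ (set_valP j).
move=> N3 [a1 [a2 [c3 [sN3 [a1s a2s] [p1 p2] e1 e2]]]].
have /choice[y yP] : forall j, exists y : aut M, forall Sj : S j,
    stable (dom N3) y /\ forall x, dom N3 x -> y x = c3 (exist _ j (mem_set Sj)) x.
  move=> j; have [Sj|nSj] := pselect (S j); last by exists 1%g.
  have [y ys yc] := extend_aut (c3 (exist _ j (mem_set Sj))) sN3; exists y => Sj'.
  by rewrite (Prop_irrelevance Sj' Sj).
have [N1N3 _ _] := prec_sub hK p1; have [N2N3 _ _] := prec_sub hK p2.
(* Conjugating by the inverse of [a1] puts [D1] back in place. The embedding of [D2] becomes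
   [a1^-1 * a2], which fixes [D0] pointwise because both factors do. *)
exists ((a1^-1)%g @` dom N3), (a1^-1 * a2)%g, (fun j => a1^-1 * (y j * a1))%g.
have inD3 x : ((a1^-1)%g @` dom N3) x <-> dom N3 (a1 x).
  by rewrite image_autE invgK.
split.
- by apply: good_image; exact: small_sub_good.
- by move=> x Nx; apply/inD3/N1N3; exists x.
- by move=> x Nx; rewrite autM a2s //; rewrite -{1}(a1s x) // autK.
- by move=> x Nx; apply/inD3; rewrite autM autKV; apply: N2N3; exists x.
- move=> j Sj; have [ys yc] := yP j Sj; split.
  + by move=> x; rewrite !inD3 !autM autKV ys.
  + move=> x Nx; rewrite !autM yc; last by apply: N1N3; exists x.
    rewrite e1; last by exists x.
    by rewrite !autK c1P.
  + move=> x Nx; rewrite !autM autKV yc; last by apply: N2N3; exists x.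
    rewrite e2; last by exists x.
    by rewrite autK c2P.
Qed.

End Good.

(** * Generic sequences *)

Section Generic.
Variables (L : language) (K : ordered_class L) (T : Type) (M : structure L T).
Variable LS : Type.
Hypothesis hK : is_AEC K.
Hypothesis hM : inK K M.
Hypothesis hLS : LS_bound K LS.
Hypothesis hkappa : [set: LS] #< dom M.
Hypothesis hpow : is_weak_power (dom M) (dom M).
Hypothesis hhom : homogeneous K M.
Hypothesis hamalg : strong_amalgamation_class K M.
Local Notation I := (set_type (dom M)).
Variable le : rel I.
Hypothesis wo : wochoice.well_order le.
Hypothesis seg_small : forall i, small (dom M) [set j | le j i].
Local Notation lt i j := (le i j /\ i <> j).
Local Notation good := (good K M).
Implicit Types (D E : set T) (i j k t : I).

Let Mnat := kappa_nat hLS hkappa.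
Let Mfun := weak_power_fun hpow.
Let Mprod := weak_power_prod hpow Mnat.
Let closure := good_closure hK hM hLS hkappa hpow.
Let bigcup_small := small_bigcup Mfun Mprod.
Let U_small := smallU Mfun Mprod Mnat.

Lemma exists_index : exists idx : T -> I, forall m, dom M m -> val (idx m) = m.
Proof.
have [m0 Mm0] := dom_neq0 M.
have /choice[idx idxP] : forall m, exists i : I, dom M m -> val i = m.
  move=> m; have [Mm|nm] := pselect (dom M m); first by exists (exist _ m (mem_set Mm)).
  by exists (exist _ m0 (mem_set Mm0)).
by exists idx.
Qed.

Lemma small_dom_bounded (A : set T) (i0 : I) : small (dom M) A -> A `<=` dom M ->
  exists i, le i0 i /\ forall j, A (val j) -> le j i.
Proof.
move=> sA AM; have [idx idxP] := exists_index.
have [i iP] := small_bounded Mfun Mprod wo seg_small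
  (U_small (small1 Mnat i0) (small_image idx sA)).
exists i; split; first by apply: iP; left.
by move=> j Aj; apply: iP; right; exists (val j) => //; apply/val_inj/idxP/AM.
Qed.

Lemma seg_union i (D : I -> set T) : (exists j, lt j i) ->
  (forall j, lt j i -> good (D j)) ->
  (forall j k, le j k -> lt k i -> D j `<=` D k) ->
  good (\bigcup_(j in [set j | lt j i]) D j).
Proof.
move=> [j ji] gD mono; rewrite bigcup_set_type.
apply: (good_union hK hLS hkappa hpow (@wo_restrict _ _ wo _)).
- by constructor; exists j; exact: mem_set.
- by apply/small_set_type/lt_seg_small.
- by move=> k; exact: gD (set_valP k).
- by move=> k l kl; exact: mono kl (set_valP l).
Qed.

Lemma seg_glue i (D : I -> set T) (h : I -> aut M) :
  (forall j, lt j i -> good (D j)) ->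
  (forall j k, le j k -> lt k i -> D j `<=` D k) ->
  (forall j k m, le j k -> lt k i -> D j m -> h k m = h j m) ->
  exists g : aut M, forall j m, lt j i -> D j m -> g m = h j m.
Proof.
move=> gD mono coh.
have [[j ji]|nj] := pselect (exists j, lt j i); last first.
  by exists 1%g => j m ji; case: nj; exists j.
pose P := [set j | lt j i].
have [|||||g gP] := @good_glue _ _ _ _ _ hK hLS hkappa hpow hhom P _
    (fun j : P => D (val j)) (fun j : P => h (val j)) (@wo_restrict _ _ wo P).
- by constructor; exists j; exact: mem_set.
- by apply/small_set_type/lt_seg_small.
- by move=> k; exact: gD (set_valP k).
- by move=> k l kl; exact: mono kl (set_valP l).
- by move=> k l m kl; exact: coh kl (set_valP l).
by exists g => k m ki; exact: (gP (exist _ k (mem_set ki))).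
Qed.

Lemma chain_glue (D : I -> set T) (h : I -> aut M) :
  (forall i, good (D i)) -> (forall i, D i (val i)) ->
  (forall i j, le i j -> D i `<=` D j) ->
  (forall i j m, le i j -> D i m -> h j m = h i m) ->
  (forall m, dom M m -> exists i, D i ((h i)^-1%g m)) ->
  exists g : aut M, forall i m, D i m -> g m = h i m.
Proof.
move=> gD Dv mono coh onto; have [m0 Mm0] := dom_neq0 M.
have sD i := (gD i).1.
apply: (glue_aut hK wo _ sD mono coh); first by constructor; exists m0; exact: mem_set.
- apply/seteqP; split=> [m [i _]|m Mm]; first exact: strong_sub (sD i) m.
  by exists (exist _ m (mem_set Mm)) => //; exact: (Dv (exist _ m (mem_set Mm))).
- apply/seteqP; split=> [_ [i _ [m Dm <-]]|m /onto[i Di]].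
    by apply: aut_dom; exact: strong_sub (sD i) m Dm.
  by exists i => //; exists ((h i)^-1%g m); rewrite ?autKV.
Qed.

(* An instance of the extension property in [generic] below, for the sequence
   [u k * om (tk_index k)], [k <= tk_len], whose [u] is still to be built. *)
Record task := Task {
  tk_len : I; tk_index : I -> I; tk_base : set T; tk_ext : set T; tk_aut : I -> aut M
}.

(* Only the restrictions of [tk_index] and [tk_aut] matter, so a task is coded
   by finitely many small sets; each code recurs cofinally. *)
Lemma exists_tasks : exists tau : I -> task,
  forall t w D D1 (x : I -> aut M) k, good D -> good D1 -> exists i,
  [/\ le k i, tk_len (tau i) = t, tk_base (tau i) = D, tk_ext (tau i) = D1 &
     forall j, le j t -> tk_index (tau i) j = w j /\
       forall m, D1 m -> tk_aut (tau i) j m = x j m].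
Proof.
have eI : enumerated (dom M) [set: I] by exists id => v _; exists v.
have eM : enumerated (dom M) (dom M).
  by exists val => v Mv; exists (exist _ v (mem_set Mv)).
have eP := enumerated_prod Mprod.
have eS V (C : set V) : enumerated (dom M) C -> _ :=
  @enumerated_small _ Mfun Mprod _ wo seg_small _ C.
pose code (c : task) := (tk_len c,
  [set p | exists2 j, le j (tk_len c) & p = (j, tk_index c j)],
  tk_base c, tk_ext c,
  [set p | exists j m, [/\ le j (tk_len c), tk_ext c m & p = (j, (m, tk_aut c j m))]]).
have [e erec] := enumerated_recurring Mprod wo seg_small
  (eP _ _ _ _ (eP _ _ _ _ (eP _ _ _ _ (eP _ _ _ _ eI (eS _ _ (eP _ _ _ _ eI eI)))
  (eS _ _ eM)) (eS _ _ eM)) (eS _ _ (eP _ _ _ _ eI (eP _ _ _ _ eM eM)))).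
have [m0 Mm0] := dom_neq0 M; pose i0 : I := exist _ m0 (mem_set Mm0).
(* The task at [i] is any one with code [e i], and a dummy if there is none. *)
have /choice[tau tauP] : forall i, exists c, (exists c', code c' = e i) -> code c = e i.
  move=> i; have [[c ci]|nc] := pselect (exists c', code c' = e i); first by exists c.
  by exists (Task i0 id set0 set0 (fun=> 1%g)).
exists tau => t w D D1 x k gD gD1.
have [|i ki ei] := erec (code (Task t w D D1 x)) k.
  have goodP D' : good D' -> [/\ D' !=set0, D' `<=` dom M & small (dom M) D'].
    by move=> gD'; split; [exact: strong_neq0 gD'.1|exact: good_sub gD'|exact: gD'.2].
  split; [split; [split; [split; [by []|]|exact: goodP]|exact: goodP]|].
    split=> //=; first by exists (t, w t), t => //; exact: wo_refl.
    apply: (sub_small _ (small_image (fun j => (j, w j)) (seg_small t))).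
    by move=> _ [j jt ->]; exists j.
  split=> /=.
  - have [m D1m] := strong_neq0 gD1.1; exists (t, (m, x t m)), t, m.
    by split=> //; exact: wo_refl.
  - move=> _ [j [m [jt D1m ->]]]; have Mm := good_sub hK gD1 D1m.
    by split=> //; split=> //; exact: aut_dom.
  - have := small_image2 Mfun Mprod (fun j m => (j, (m, x j m))) (seg_small t) gD1.2.
    by apply: sub_small.
have /tauP : exists c', code c' = e i by exists (Task t w D D1 x); rewrite ei.
rewrite ei /code => ce; exists i.
case: (tau i) ce => t' w' D' D1' x' /= [et ew eD eD1 ex].
rewrite {}et {}eD {}eD1 in ew ex *; split=> // j jt; split.
  have : [set p | exists2 j, le j t & p = (j, w j)] (j, w j) by exists j.
  by rewrite -ew => -[j' _ [<- ->]].
move=> m D1m.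
have : [set p | exists j m, [/\ le j t, D1 m & p = (j, (m, x j m))]] (j, (m, x j m)).
  by exists j, m.
by rewrite -ex => -[j' [m' [_ _ [<- <- ->]]]].
Qed.

Definition generic t (y : I -> aut M) := forall D D1 (x : I -> aut M),
  good D -> good D1 -> D `<=` D1 ->
  (forall k, le k t -> [/\ stable D (y k), stable D1 (x k) &
     forall m, D m -> y k m = x k m]) ->
  exists2 b : aut M, pw_stab D b & forall k m, le k t -> D1 m -> y k (b m) = b (x k m).

(** Stage [i] consists of a small strong set and of approximations to all [u k], binding on that
    set; those with [k] up to [i] stabilize it. The [i]-th task, if meaningful for the current
    approximation, is solved by amalgamation. Tasks recur cofinally, so each one is met after
    everything it mentions has been decided. Since a task names its own [w], one [u] serves all
    choices of [w]. *)
Lemma generic_sequence (om : I -> aut M) : exists u : I -> aut M,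
  forall t (w : I -> I), generic t (fun k => u k * om (w k))%g.
Proof.
have [tau tauP] := exists_tasks.
pose ready i (u : I -> aut M) := let: Task t w D D1 x := tau i in
  [/\ le t i, good D, good D1, D `<=` D1 & forall k, le k t ->
    [/\ stable D (u k * om (w k))%g, stable D1 (x k) &
     forall m, D m -> u k (om (w k) m) = x k m]].
(* The points where [u k] is evaluated must lie in [D']: later stages preserve the values there,
   hence also the solution. *)
pose solved i (D' : set T) (u : I -> aut M) := let: Task t w D D1 x := tau i in
  exists2 b : aut M, pw_stab D b & forall k m, le k t -> D1 m ->
    D' (om (w k) (b m)) /\ u k (om (w k) (b m)) = b (x k m).
pose P i (f : I -> set T * (I -> aut M)) (s : set T * (I -> aut M)) :=
  [/\ good s.1 /\ s.1 (val i),
      forall j, lt j i -> (f j).1 `<=` s.1,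
      forall j k m, lt j i -> (f j).1 m -> s.2 k m = (f j).2 k m,
      forall k, le k i -> stable s.1 (s.2 k) &
      ready i s.2 -> solved i s.1 s.2].
have [||f fP] := wo_recursion wo (set0, fun=> 1%g) (P := P).
- move=> i f g s fg [s1 s2 s3 s4 s5]; split=> // [j|j k m] ji.
    by rewrite -fg ?ji.1 //; [exact: s2|exact: ji.2].
  by rewrite -fg ?ji.1 //; [exact: s3|exact: ji.2].
- move=> i f IH.
  have gf j : lt j i -> good (f j).1 by move=> [ji nji]; case: (IH _ ji nji) => -[].
  have mono j k : le j k -> lt k i -> (f j).1 `<=` (f k).1.
    move=> jk [ki nki]; have [->//|njk] := pselect (j = k).
    by case: (IH _ ki nki) => _ + _ _ _; apply.
  have coh l j k m : le j k -> lt k i -> (f j).1 m -> (f k).2 l m = (f j).2 l m.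
    move=> jk [ki nki] fm; have [->//|njk] := pselect (j = k).
    by case: (IH _ ki nki) => _ _ + _ _; apply.
  have /choice[v vP] : forall l, exists g : aut M,
      forall j m, lt j i -> (f j).1 m -> g m = (f j).2 l m.
    by move=> l; exact: seg_glue gf mono (coh l).
  pose E := \bigcup_(j in [set j | lt j i]) (f j).1 `|` [set val i].
  have sE : small (dom M) E.
    apply: U_small (small1 Mnat _); apply: bigcup_small; first exact: lt_seg_small.
    by move=> j /gf[].
  have EM : E `<=` dom M.
    by move=> m [[j /gf/(good_sub hK)]|->]; [exact|exact: set_valP].
  have [rdy|nrdy] := pselect (ready i v); last first.
    have [D [gD ED Dst]] := closure v (seg_small i) sE EM.
    exists (D, v); split=> //=.
    + by split=> //; apply: ED; right.
    + by move=> j ji m fm; apply: ED; left; exists j.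
    + by move=> j k m ji fm; exact: vP.
  move: rdy; rewrite /P /ready /solved; case: (tau i) => t w D0 D1 x [ti gD0 gD1 D01 xP].
  pose X := [set p : bool * I | le p.2 i].
  have sX : small (dom M) X.
    have sb : small (dom M) [set: bool].
      by apply: sub_small (small_image odd Mnat) => -[] _; [exists 1|exists 0].
    apply: sub_small (small_image2 Mfun Mprod pair sb (seg_small i)).
    by move=> [b k] /= ki; exists b, k.
  (* [N] is stabilized both by the approximations and by the translations, so the products act on it
     and can be amalgamated with the [x k] over [D0]. *)
  have [||N [gN AN Nst]] := closure (fun p => if p.1 then v p.2 else om (w p.2)) sX
      (A := E `|` D0).
  + by apply: U_small => //; exact: gD0.2.
  + by move=> m [/EM//|/(good_sub hK gD0)].
  have Nv k : le k i -> stable N (v k) by exact: (Nst (true, k)).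
  have Nom k : le k i -> stable N (om (w k)) by exact: (Nst (false, k)).
  have xP' k : le k t -> [/\ stable D0 (v k * om (w k))%g, stable N (v k * om (w k))%g,
      stable D1 (x k) & forall m, D0 m -> (v k * om (w k))%g m = x k m].
    move=> kt; have [xP1 xP2 xP3] := xP k kt; have ki := wo_trans wo kt ti.
    by split=> //; apply: stableM; [exact: Nv|exact: Nom].
  have [D3 [b [x3 [gD3 ND3 bD0 bD1 x3P]]]] := amalgamation hK hhom hamalg
    (seg_small t) gD0 gN gD1 (fun m D0m => AN m (or_intror D0m)) D01 xP'.
  (* This choice makes [u k * om (w k)] equal to the amalgam [x3 k]. It does not change [v k] on
     [N], because [om (w k)] permutes [N] and [x3 k] extends the product there. *)
  pose u k : aut M := if le k t then (x3 k * (om (w k))^-1)%g else v k.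
  have uE k m : N m -> u k m = v k m.
    move=> Nm; rewrite /u; case: ifP => // kt; have [_ x3N _] := x3P _ kt.
    have ki := wo_trans wo kt ti.
    by rewrite autM x3N ?autM ?autKV //; apply/(stableV (Nom _ ki)).
  have [D [gD D3D Dst]] := closure (fun p => if p.1 then u p.2 else om (w p.2)) sX
    gD3.2 (good_sub hK gD3).
  exists (D, u); split=> /=.
  + by split=> //; apply/D3D/ND3/AN; left; right.
  + by move=> j ji m fm; apply/D3D/ND3/AN; left; left; exists j.
  + move=> j k m ji fm; rewrite uE ?(vP _ _ _ ji fm) //.
    by apply: AN; left; left; exists j.
  + by move=> k; exact: (Dst (true, k)).
  + move=> _; exists b => // k m kt D1m; have [_ _ x3b] := x3P _ kt; split.
      by apply/(Dst (false, k) (wo_trans wo kt ti))/D3D/bD1.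
    by rewrite /u kt autM autK x3b.
have gf i : good (f i).1 by case: (fP i) => -[].
have mono i j : le i j -> (f i).1 `<=` (f j).1.
  move=> ij; have [->//|nij] := pselect (i = j).
  by case: (fP j) => _ + _ _ _; apply.
have coh k i j m : le i j -> (f i).1 m -> (f j).2 k m = (f i).2 k m.
  move=> ij fm; have [->//|nij] := pselect (i = j).
  by case: (fP j) => _ _ + _ _; apply.
have fst k i : le k i -> stable (f i).1 ((f i).2 k) by case: (fP i) => _ _ _ + _; apply.
have fv i : (f i).1 (val i) by case: (fP i) => -[].
have /choice[u uP] : forall k, exists g : aut M, forall i m, (f i).1 m -> g m = (f i).2 k m.
  move=> k; apply: chain_glue => // [|m Mm]; first exact: coh.
  pose i : I := exist _ m (mem_set Mm); have [j [ij kj]] := wo_max wo i k.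
  by exists j; apply/(stableV (fst _ _ kj)); exact: (mono _ _ ij _ (fv i)).
exists u => t w D D1 x gD gD1 D01 xP.
have [||i0 [ti0 i0P]] := @small_dom_bounded
  (\bigcup_(k in [set k | le k t]) (om (w k) @` D)) t.
- by apply: bigcup_small => // k _; apply: small_image; exact: gD.2.
- by move=> _ [k _ [m Dm <-]]; apply: aut_dom; exact: good_sub gD _ Dm.
have [i [i0i ti Di D1i wx]] := tauP t w D D1 x i0 gD gD1.
have omD k m : le k t -> D m -> (f i).1 (om (w k) m).
  move=> kt Dm; have Mm : dom M (om (w k) m) by apply: aut_dom; exact: good_sub gD _ Dm.
  pose j : I := exist _ (om (w k) m) (mem_set Mm).
  apply: (mono j i); last exact: (fv j).
  apply: (wo_trans wo _ i0i); apply: i0P; exists k => //; by exists m.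
have [_ _ _ _] := fP i; rewrite /ready /solved.
case: (tau i) ti Di D1i wx => t' w' D' D1' x' /= -> -> -> wx [|b bD bP].
  split=> //; first exact: (wo_trans wo ti0 i0i).
  move=> k kt; have [-> x'x] := wx k kt; have [xP1 xP2 xP3] := xP k kt.
  have uf m : D m -> u k (om (w k) m) = (f i).2 k (om (w k) m).
    by move=> Dm; apply: uP; exact: omD.
  split.
  - exact: eq_stable xP1.
  - by apply: eq_stable xP2 => m D1m; rewrite x'x.
  - by move=> m Dm; rewrite -uf // [LHS]xP3 // x'x //; exact: D01.
exists b => // k m kt D1m; have [wk x'x] := wx k kt.
have [fb ub] := bP k m kt D1m; rewrite wk in fb ub.
by rewrite [LHS](uP _ _ _ fb) ub x'x.
Qed.

Lemma extend_conjugation t (a z : I -> aut M) E (h : aut M) p :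
  generic t z -> good E -> dom M p ->
  (forall k, le k t -> stable E (a k) /\ forall m, E m -> h (a k m) = z k (h m)) ->
  exists D (h' : aut M), [/\ good D, E `<=` D /\ D p, forall m, E m -> h' m = h m &
   forall k, le k t -> stable D (a k) /\ forall m, D m -> h' (a k m) = z k (h' m)].
Proof.
move=> gz gE Mp aP.
have [||D [gD AD Dst]] := closure a (seg_small t) (A := E `|` [set p]).
- by apply: U_small (small1 Mnat _); exact: gE.2.
- by move=> m [/(good_sub hK gE)|->].
have [||||b bE bP] := gz (h @` E) (h @` D) (fun k => h * (a k * h^-1))%g.
- exact: good_image.
- exact: good_image.
- by move=> _ [m Em <-]; exists m => //; apply: AD; left.
- move=> k kt; have [aE haz] := aP _ kt.
  have agree m : (h @` E) m -> (h * (a k * h^-1))%g m = z k m.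
    by move=> [y Ey <-]; rewrite !autM autK haz.
  split.
  + by apply: (eq_stable agree); exact: stable_conj.
  + by apply: stable_conj; exact: Dst.
  + by move=> m /agree.
exists D, (b * h)%g; split=> //.
- by split=> [m Em|]; apply: AD; [left|right].
- by move=> m Em; rewrite autM bE //; exists m.
- move=> k kt; split=> [|m Dm]; first exact: Dst.
  have hDm : (h @` D) (h m) by exists m.
  by rewrite !autM (bP _ _ kt hDm) !autM autK.
Qed.

(** The back step is the forth step for the inverse map with [a] and [z] exchanged, so [h'] is the
    inverse of the resulting [h2]. *)
Lemma back_and_forth t (a z : I -> aut M) E (h : aut M) p :
  generic t a -> generic t z -> good E -> dom M p ->
  (forall k, le k t -> stable E (a k) /\ forall m, E m -> h (a k m) = z k (h m)) ->
  exists D (h' : aut M), [/\ good D, E `<=` D, D p /\ D ((h'^-1)%g p),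
   forall m, E m -> h' m = h m &
   forall k, le k t -> stable D (a k) /\ forall m, D m -> h' (a k m) = z k (h' m)].
Proof.
move=> ga gz gE Mp /(extend_conjugation gz gE Mp)[D1 [h1 [gD1 [ED1 D1p] h1E h1P]]].
have [||D2 [h2 [gD2 [D12 D2p] h2E h2P]]] :=
  @extend_conjugation t z a (h1 @` D1) (h1^-1)%g p ga _ Mp.
- exact: good_image.
- move=> k kt; have [aD1 haz] := h1P _ kt.
  have agree m : (h1 @` D1) m -> (h1 * (a k * h1^-1))%g m = z k m.
    by move=> [y Dy <-]; rewrite !autM autK haz.
  split; last by move=> _ [m Dm <-]; rewrite -haz // !autK.
  by apply: (eq_stable agree); exact: stable_conj.
have h2V m : D1 m -> h2 (h1 m) = m by move=> Dm; rewrite h2E ?autK //; exists m.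
exists (h2 @` D2), (h2^-1)%g; split.
- exact: good_image.
- by move=> m /ED1 Dm; exists (h1 m); [apply: D12; exists m|exact: h2V].
- split; last by rewrite invgK; exists p.
  by exists (h1 p); [apply: D12; exists p|exact: h2V].
- by move=> m Em; apply: (@aut_inj _ _ _ h2); rewrite autKV -(h1E _ Em) h2V //; exact: ED1.
- move=> k kt; have [zD2 hza] := h2P _ kt.
  have agree m : (h2 @` D2) m -> (h2 * (z k * h2^-1))%g m = a k m.
    by move=> [y Dy <-]; rewrite !autM autK hza.
  split; last by move=> _ [m Dm <-]; rewrite -hza // !autK.
  by apply: (eq_stable agree); exact: stable_conj.
Qed.

(** * Subgroups of index at most kappa *)

Section SmallIndex.
Variable H : set (aut M).
Hypothesis H1 : H 1%g.
Hypothesis HM : forall g h, H g -> H h -> H (g * h)%g.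
Hypothesis HV : forall g, H g -> H (g^-1)%g.
Hypothesis hindex : cosets H #<= dom M.

Lemma left_cosetP g h : left_coset H g = left_coset H h <-> H (g^-1 * h)%g.
Proof.
split=> [e|Hgh].
  have : left_coset H h h by exists 1%g => //; exact: mulg1.
  by rewrite -e => -[k Hk <-]; rewrite mulKg.
apply/seteqP; split=> _ [k Hk <-].
  exists ((g^-1 * h)^-1 * k)%g; first by apply: HM => //; exact: HV.
  by rewrite invgM invgK -!mulgA mulVKg.
by exists (g^-1 * h * k)%g; [exact: HM|rewrite -!mulgA mulVKg].
Qed.

Lemma enumerated_cosets : enumerated (dom M) (cosets H).
Proof. exact: (card_le_enumerated set0 hindex). Qed.

(** The condition on [H] says that [om k] lies in the left coset of [f] modulo the conjugate of [H]
    by [g]. It depends only on the cosets of [g] and [f * g], so with the restriction of [f] to [D]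
    there are at most kappa requirements. *)
Lemma exists_translations : exists om : I -> aut M, forall (g f : aut M) D, good D ->
  exists k, (forall m, D m -> om k m = f m) /\ H (g^-1 * ((om k)^-1 * (f * g)))%g.
Proof.
have eP := enumerated_prod Mprod.
have eM : enumerated (dom M) (dom M).
  by exists val => v Mv; exists (exist _ v (mem_set Mv)).
have [e eC] := eP _ _ _ _ enumerated_cosets (eP _ _ _ _ enumerated_cosets
  (enumerated_small Mfun Mprod wo seg_small (eP _ _ _ _ eM eM))).
pose code (g f : aut M) D :=
  (left_coset H g, (left_coset H (f * g)%g, [set p | exists2 m, D m & p = (m, f m)])).
have /choice[om omP] : forall k, exists f : aut M,
    (exists g f' D, code g f' D = e k) -> exists g D, code g f D = e k.
  move=> k; have [[g [f [D c]]]|n] := pselect (exists g f' D, code g f' D = e k).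
    by exists f => _; exists g, D.
  by exists 1%g.
exists om => g f D gD.
have [|k ek] := eC (code g f D).
  split; first by exists g.
  split; first by exists (f * g)%g.
  split=> /=.
  - by have [m Dm] := strong_neq0 gD.1; exists (m, f m), m.
  - move=> _ [m Dm ->]; have Mm := good_sub hK gD Dm.
    by split=> //; exact: aut_dom.
  - have := small_image (fun m => (m, f m)) gD.2.
    by apply: sub_small => _ [m Dm ->]; exists m.
have [|g' [D' ]] := omP k; first by exists g, f, D.
rewrite ek => -[/left_cosetP gg' /left_cosetP fg graph]; exists k; split.
  move=> m Dm; have : [set p | exists2 m, D m & p = (m, f m)] (m, f m) by exists m.
  by rewrite -graph => -[m' _ [<- ->]].
by have := HM (HV gg') fg; rewrite !invgM !invgK -!mulgA mulVKg.
Qed.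

Lemma small_index_contains_stabilizer : exists2 D, good D & pw_stab D `<=` H.
Proof.
apply: contrapT => nD.
(* If the stabilizer of [D] lay inside the conjugate of [H] by [g], the stabilizer of the preimage
   of [D] under [g] would lie in [H]. *)
have esc D (g : aut M) : good D -> exists2 v, pw_stab D v & ~ H (g^-1 * (v * g))%g.
  move=> gD; have gD' : good ((g^-1)%g @` D) := good_image hK _ gD.
  apply: contrapT => nv; apply: nD; exists ((g^-1)%g @` D) => // v vD.
  apply: contrapT => nHv; apply: nv; exists (g * (v * g^-1))%g; last first.
    by rewrite -!mulgA mulVg mulg1 mulKg.
  move=> m Dm; rewrite !autM vD ?autKV //; by exists m.
have [cr crP] : exists cr : I -> aut M, forall h, exists j, H ((cr j)^-1 * h)%g.
  have [e eP] := enumerated_cosets.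
  have /choice[cr crP] : forall j, exists g,
      (exists h, e j = left_coset H h) -> e j = left_coset H g.
    move=> j; have [[h ej]|n] := pselect (exists h, e j = left_coset H h); first by exists h.
    by exists 1%g.
  exists cr => h; have [|j ej] := eP (left_coset H h); first by exists h.
  by exists j; apply/left_cosetP; rewrite -crP //; exists h.
have [om omP] := exists_translations.
have [u uP] := generic_sequence om.
have [p0 Mp0] := dom_neq0 M.
have [|B0 gB0 _] := good_hull hM hLS hkappa hpow (small1 Mnat p0); first by move=> _ ->.
(* A stage records a domain, an approximation of [h] binding on that domain, and the indices in [om]
   of the two translations chosen at this stage. *)
pose S := (set T * aut M * (I * I))%type.
pose al j (s : S) : aut M := (u j * om s.2.1)%g.
pose ze j (s : S) : aut M := (u j * om s.2.2)%g.
pose conj (D : set T) (h : aut M) (a z : aut M) :=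
  stable D a /\ forall m, D m -> h (a m) = z (h m).
pose P i (f : I -> S) (s : S) :=
  [/\ good s.1.1 /\ (s.1.1 (val i) /\ s.1.1 ((s.1.2)^-1%g (val i))),
      forall j, lt j i -> (f j).1.1 `<=` s.1.1,
      forall j m, lt j i -> (f j).1.1 m -> s.1.2 m = (f j).1.2 m,
      (forall j, lt j i -> conj s.1.1 s.1.2 (al j (f j)) (ze j (f j))) /\
        conj s.1.1 s.1.2 (al i s) (ze i s) &
      H (al i s) /\ ~ H ((cr i)^-1 * (ze i s * cr i))%g].
pose i0 : I := exist _ p0 (mem_set Mp0).
have [||f fP] := wo_recursion wo ((set0, 1%g, (i0, i0)) : S) (P := P).
- move=> i f g s fg [s1 s2 s3 [s4 s4'] s5]; split=> // [j|j m|] .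
  + by move=> ji; rewrite -fg ?ji.1 //; [exact: s2|exact: ji.2].
  + by move=> ji; rewrite -fg ?ji.1 //; [exact: s3|exact: ji.2].
  + by split=> // j ji; rewrite -fg ?ji.1 //; [exact: s4|exact: ji.2].
- move=> i f IH.
  have gf j : lt j i -> good (f j).1.1 by move=> [ji nji]; case: (IH _ ji nji) => -[].
  have mono j k : le j k -> lt k i -> (f j).1.1 `<=` (f k).1.1.
    move=> jk [ki nki]; have [->//|njk] := pselect (j = k).
    by case: (IH _ ki nki) => _ + _ _ _; apply.
  have coh j k m : le j k -> lt k i -> (f j).1.1 m -> (f k).1.2 m = (f j).1.2 m.
    move=> jk [ki nki] fm; have [->//|njk] := pselect (j = k).
    by case: (IH _ ki nki) => _ _ + _ _; apply.
  have cnj j k : le j k -> lt k i -> conj (f k).1.1 (f k).1.2 (al j (f j)) (ze j (f j)).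
    move=> jk [ki nki]; case: (IH _ ki nki) => _ _ _ [c1 c2] _.
    by have [->//|njk] := pselect (j = k); exact: c1.
  have [h hP] := seg_glue gf mono coh.
  (* [E] is the union of the earlier domains, and the arbitrary [B0] at the least stage, where there
     is nothing to preserve. *)
  have [E [gE fE EU]] : exists E, [/\ good E, forall j, lt j i -> (f j).1.1 `<=` E &
      (exists j, lt j i) -> forall m, E m -> exists2 j, lt j i & (f j).1.1 m].
    have [ex|nex] := pselect (exists j, lt j i); last first.
      by exists B0; split=> // j ji; case: nex; exists j.
    exists (\bigcup_(j in [set j | lt j i]) (f j).1.1); split.
    - exact: seg_union.
    - by move=> j ji m fm; exists j.
    - by move=> _ m [j ji fm]; exists j.
  have cE j : lt j i -> conj E h (al j (f j)) (ze j (f j)).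
    move=> ji.
    have above m : E m -> exists k, [/\ le j k, lt k i & (f k).1.1 m].
      move=> Em; have [|k ki fm] := EU _ m Em; first by exists j.
      have [jk|kj] := wo_total wo j k; first by exists k.
      by exists j; split=> //; [exact: wo_refl|exact: mono fm].
    split=> m; first split=> Em.
    - have [k [jk ki fk]] := above _ Em; have [st _] := cnj _ _ jk ki.
      by apply: (fE _ ki); exact/st.
    - have [k [jk ki fk]] := above _ Em; have [st _] := cnj _ _ jk ki.
      by apply: (fE _ ki); exact/st.
    - move=> Em; have [k [jk ki fk]] := above _ Em; have [st c] := cnj _ _ jk ki.
      by rewrite !(hP k) // ?c //; exact/st.
  have [ka [ka1 ka2]] := omP 1%g (u i)^-1%g E gE.
  have [v vE nv] := esc (h @` E) (cr i) (good_image hK h gE).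
  have [kz [kz1 kz2]] := omP (cr i) ((u i)^-1 * v)%g _ (good_image hK h gE).
  pose wa k := if pselect (k = i) then ka else (f k).2.1.
  pose wz k := if pselect (k = i) then kz else (f k).2.2.
  have wai : wa i = ka by rewrite /wa; case: pselect.
  have wzi : wz i = kz by rewrite /wz; case: pselect.
  have waj j : j <> i -> wa j = (f j).2.1 by rewrite /wa; case: pselect.
  have wzj j : j <> i -> wz j = (f j).2.2 by rewrite /wz; case: pselect.
  have fixa m : E m -> (u i * om ka)%g m = m by move=> Em; rewrite autM ka1 // autKV.
  have fixz m : (h @` E) m -> (u i * om kz)%g m = m.
    by move=> Em; rewrite autM kz1 // autM autKV vE.
  have cw k : le k i -> conj E h (u k * om (wa k))%g (u k * om (wz k))%g.
    move=> ki; have [->|nki] := pselect (k = i).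
      rewrite wai wzi; split=> [|m Em].
        by apply: (@eq_stable _ _ _ _ 1%g) => // m Em; rewrite fixa.
      by rewrite fixa // fixz //; exists m.
    by rewrite waj // wzj //; exact: cE.
  (* Genericity of [u] for every translation sequence lets the new choices at [i] join the old ones;
     all conjugation requirements up to [i] are extended at once, with [val i] put into the domain
     and the range. *)
  have [D [h' [gD ED [Dp Dp'] h'E cD]]] :=
    back_and_forth (uP i wa) (uP i wz) gE (set_valP i) cw.
  exists (D, h', (ka, kz)); split=> //=.
  + by move=> j ji m fm; apply: ED; exact: fE fm.
  + by move=> j m ji fm; rewrite h'E ?(hP j) //; exact: fE fm.
  + split; last by have := cD i (wo_refl wo i); rewrite wai wzi.
    by move=> j [ji nji]; have := cD j ji; rewrite waj // wzj.
  + split.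
      by have := HV ka2; rewrite invg1 mul1g mulg1 -invgM invgK.
    move=> Hz; apply: nv; have := HM Hz kz2.
    by rewrite /ze /= -!mulgA !mulVKg.
have gf i : good (f i).1.1 by case: (fP i) => -[].
have mono i j : le i j -> (f i).1.1 `<=` (f j).1.1.
  move=> ij; have [->//|nij] := pselect (i = j).
  by case: (fP j) => _ + _ _ _; apply.
have coh i j m : le i j -> (f i).1.1 m -> (f j).1.2 m = (f i).1.2 m.
  move=> ij fm; have [->//|nij] := pselect (i = j).
  by case: (fP j) => _ _ + _ _; apply.
have cnj j k : le j k -> conj (f k).1.1 (f k).1.2 (al j (f j)) (ze j (f j)).
  move=> jk; case: (fP k) => _ _ _ [c1 c2] _.
  by have [->//|njk] := pselect (j = k); exact: c1.
have fv i : (f i).1.1 (val i) by case: (fP i) => -[_ []].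
have [|h hP] := chain_glue gf fv mono coh.
  move=> m Mm; exists (exist _ m (mem_set Mm)).
  by case: (fP (exist _ m (mem_set Mm))) => -[_ []].
(* As [h] lies in the coset of [cr j], conjugation by [h] sends [H] into the conjugate of [H] by
   [cr j]. It also sends [al j (f j)], an element of [H], to [ze j (f j)], which was chosen outside
   that conjugate. *)
have [j Hj] := crP h; have [_ _ _ _ [Ha nHz]] := fP j.
apply: nHz.
have -> : ze j (f j) = (h * (al j (f j) * h^-1))%g.
  apply: aut_eq => m; rewrite !autM.
  have [Mm|nMm] := pselect (dom M m); last by rewrite !aut_out.
  have Mhm : dom M ((h^-1)%g m) by exact: aut_dom.
  pose i : I := exist _ ((h^-1)%g m) (mem_set Mhm).
  have [k [ik jk]] := wo_max wo i j.
  have fk : (f k).1.1 ((h^-1)%g m) by exact: (mono _ _ ik _ (fv i)).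
  have [st c] := cnj _ _ jk.
  have fak : (f k).1.1 (al j (f j) ((h^-1)%g m)) by exact/st.
  by rewrite (hP _ _ fak) c // -(hP _ _ fk) autKV.
have := HM (HM Hj Ha) (HV Hj).
by rewrite invgM invgK !mulgA.
Qed.
End SmallIndex.
End Generic.

(** * Openness in the closure topology *)

Lemma stab_coset_open (L : language) (K : ordered_class L) (T : Type)
    (M : structure L T) (U : set (aut_cl K M)) :
  @stab_cosets L K T M U -> open U.
Proof.
move=> sU; exists [set U]; last by rewrite bigcup_set1.
by move=> _ ->; exact: (finI_from1 id sU).
Qed.

(** The universe of [A] is its own closure, since [A] is one of the models intersected. *)
Lemma small_sub_closed (L : language) (K : ordered_class L) (T : Type)
    (M A : structure L T) :
  is_AEC K -> small_sub K M A -> closed_small K M (dom A).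
Proof.
move=> hK [AM Ak]; have [AK _] := prec_inK hK AM; have [AsM _ _] := prec_sub hK AM.
exists (dom A) => //; apply/seteqP; split=> x.
  by move=> /(_ A); apply; split.
by move=> Ax N [_ + _]; apply.
Qed.

Theorem theorem4p1 (L : language) (K : ordered_class L) (T : Type)
    (M : structure L T) (LS : Type)
    (hK : is_AEC K) (hM : inK K M)
    (hLS : is_LS_number K LS) (hkappa : [set: LS] #< dom M)
    (hpow : is_weak_power (dom M) (dom M))
    (hhom : homogeneous K M)
    (hamalg : strong_amalgamation_class K M)
    (H : set (aut_cl K M)) (hH : subgroup H) (hindex : cosets H #<= dom M) :
  open H /\
  exists A : structure L T, small_sub K M A /\ @pw_stab L T M (dom A) `<=` H.
Proof.
have [hLS' _] := hLS.
have H1 : H 1%g by case: hH => /set_mem.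
have HV g : H g -> H (g^-1)%g by move=> Hg; apply/set_mem/(group_closedV hH)/mem_set.
have HM g h : H g -> H h -> H (g * h)%g.
  by move=> Hg Hh; apply/set_mem; apply: (group_closedM hH); exact: mem_set.
have Mnat := kappa_nat hLS' hkappa.
have [le [wo seg_small]] := exists_initial_order (weak_power_fun hpow)
  (weak_power_prod hpow Mnat) Mnat.
have [D gD DH] := small_index_contains_stabilizer hK hM hLS' hkappa hpow hhom hamalg
  wo seg_small H1 HM HV hindex.
have [A sA dA] := good_small_sub gD; rewrite -dA in DH.
split; last by exists A.
(* A subgroup containing a basic stabilizer is a union of left cosets of that stabilizer. *)
have -> : H = \bigcup_(g in H) left_coset (@pw_stab L T M (dom A) : set (aut_cl K M)) g.
  apply/seteqP; split=> [g Hg|_ [g Hg [h /DH Hh <-]]]; last exact: HM.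
  by exists g => //; exists 1%g; rewrite ?mulg1 // => x _.
apply: bigcup_open => g _; apply: stab_coset_open.
by exists (dom A), g; split=> //; exact: small_sub_closed.
Qed.
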